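(* In the weighted regression setting described in the context (martingale difference errors with conditional variance $\sigma^2(i/n,x_i)$, weights $p_i=p(i/n,x_i)$), let $$\Sigma_1=\mathbb{E}\int_0^1p_i(u)^2\,\widetilde x_{1,i}(u)\widetilde x_{1,i}(u)'\,du,\quad \Sigma_2=\mathbb{E}\int_0^1p_i(u)^4\sigma_i(u)^2\,\widetilde x_{1,i}(u)\widetilde x_{1,i}(u)'\,du,\quad \Sigma^*=\mathbb{E}\int_0^1\frac{\widetilde x^*_{1,i}(u)\widetilde x^*_{1,i}(u)'}{\sigma_i(u)^2}\,du .$$ Then for every $z\in\mathbb{R}^{p_1}$, $$z'(\Sigma^* )^{-1}z\le z'\,\Sigma_1^{-1}\Sigma_2\Sigma_1^{-1}z,$$ and for the choice of weights $p=\sigma^{-1}$ one has $\Sigma_1^{-1}\Sigma_2\Sigma_1^{-1}=(\Sigma^* )^{-1}$.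
   Context: Prime denotes transpose (except in $\xi'$); $\Vert U\Vert_r=\mathbb{E}^{1/r}(|U|^r)$; $\mathbb{E}^{-1}[\cdot]$ is the inverse matrix of the expectation. Dependence structure. $(\xi_k)_{k\in\mathbb{Z}}$ are i.i.d. with values in a measurable space $(E,\mathcal{E})$; $\mathcal{F}_k=(\xi_k,\xi_{k-1},\ldots)$ (also the generated $\sigma$-algebra); $\mathcal{F}_{0,k}=(\xi_0,\ldots,\xi_{-k+1},\xi'_{-k},\xi_{-k-1},\ldots)$ with $\xi'$ an independent copy of $\xi$. For a triangular array of measurable functions $J_{n,i}$ on $E^{\mathbb{N}}$, $1\le i\le n$: $\delta_{k,r}(J)=\sup_{n\ge1}\max_{1\le i\le n}\Vert J_{n,i}(\mathcal{F}_0)-J_{n,i}(\mathcal{F}_{0,k})\Vert_r$, $\Theta_{m,r}(J)=\sum_{k\ge m}\delta_{k,r}(J)$; finiteness of $\Theta_{0,r}(J)$ implicitly includes $\sup_{n,i}\Vert J_{n,i}(\mathcal{F}_0)\Vert_r<\infty$. Model. $y_i=x_{1,i}'\beta_1+x_{2,i}'\beta_2(i/n)+e_i$, $1\le i\le n$, with $\beta_1\in\mathbb{R}^{p_1}$, $\beta_2:[0,1]\to\mathbb{R}^{p_2}$ Lipschitz, $d_0=p_1+p_2$, $x_i=(x_{1,i}',x_{2,i}')'=G_{n,i}(\mathcal{F}_i)\in\mathbb{R}^{d_0}$ which is $\mathcal{F}_{i-1}$-measurable, $e_i=H_{n,i}(\mathcal{F}_i)\in\mathbb{R}$, $\mathbb{E}(e_i\mid\mathcal{F}_{i-1})=0$,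 $\mathrm{Var}(e_i\mid\mathcal{F}_{i-1})=\sigma^2(i/n,x_i)$ with $\sigma:[0,1]\times\mathbb{R}^{d_0}\to(0,\infty)$. For a weight function $p:[0,1]\times\mathbb{R}^{d_0}\to\mathbb{R}$ put $p_i=p(i/n,x_i)$ and consider the weighted model $p_iy_i=p_ix_{1,i}'\beta_1+p_ix_{2,i}'\beta_2(i/n)+p_ie_i$. Assumptions on the weighted model. There are stationary approximations $x_i(u)=(x_{1,i}(u)',x_{2,i}(u)')'=G(u,\mathcal{F}_i)$ and $e_i(u)=H(u,\mathcal{F}_i)$, $u\in[0,1]$, with $x_i(u)$ $\mathcal{F}_{i-1}$-measurable, $\mathbb{E}(e_i(u)\mid\mathcal{F}_{i-1})=0$, $\mathrm{Var}(e_i(u)\mid\mathcal{F}_{i-1})=\sigma_i(u)^2$, where $\sigma_i(u)=\sigma(u,x_i(u))$ and $p_i(u)=p(u,x_i(u))$, such that, with $X_i=p_ix_i$, $\varepsilon_i=p_ie_i$, $X_i(u)=p_i(u)x_i(u)$, $\varepsilon_i(u)=p_i(u)e_i(u)$: (i) $\max_{1\le i\le n}[\Vert X_i-X_i(i/n)\Vert_2+\Vert X_i\varepsilon_i-X_i(i/n)\varepsilon_i(i/n)\Vert_2]=O(1/n)$ and, for some $C>0$, $\Vert X_i(u)-X_i(v)\Vert_2+\Vert X_i(u)\varepsilon_i(u)-X_i(v)\varepsilon_i(v)\Vert_2\le C|u-v|$; (ii) there are $q>8/7$, $q_1>16/7$, $q_2>2$ with $1/q=1/q_1+1/q_2$ and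 $\Theta_{0,2q_1}+\Theta_{0,q_2}<\infty$ for the arrays of functions defining $X_i$ and $X_i\varepsilon_i$ respectively; (iii) $\det\mathbb{E}[X_i(u)X_i(u)']\ne0$ for each $u\in[0,1]$. These assumptions hold for the weight $p$ under consideration and also for the weight $\sigma^{-1}$. Notation. $q_2(u)=\mathbb{E}^{-1}[p_i(u)^2x_{2,i}(u)x_{2,i}(u)']\,\mathbb{E}[p_i(u)^2x_{2,i}(u)x_{1,i}(u)']$, $q_2^*(u)=\mathbb{E}^{-1}[\sigma_i(u)^{-2}x_{2,i}(u)x_{2,i}(u)']\,\mathbb{E}[\sigma_i(u)^{-2}x_{2,i}(u)x_{1,i}(u)']$, $\widetilde x_{1,i}(u)=x_{1,i}(u)-q_2(u)'x_{2,i}(u)$, $\widetilde x^*_{1,i}(u)=x_{1,i}(u)-q_2^*(u)'x_{2,i}(u)$. ($\Sigma_1^{-1}\Sigma_2\Sigma_1^{-1}$ is the asymptotic variance of the partial-regression estimator of $\beta_1$ computed in the weighted model.) *)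

(* Defs.v *)
From HB Require Import structures.
From mathcomp Require Import all_boot all_order all_algebra.
From mathcomp Require Import all_classical all_reals all_analysis.

Set Implicit Arguments.
Unset Strict Implicit.
Unset Printing Implicit Defensive.

Import Order.TTheory GRing.Theory Num.Theory.
Import numFieldNormedType.Exports.

Local Open Scope classical_set_scope.
Local Open Scope ring_scope.

Definition cylinders {I aT : Type} {d} {rT : measurableType d}
    (f : I -> aT -> rT) : set (set aT) :=
  \bigcup_(i in setT) preimage_set_system setT (f i) measurable.

(* [nat -> E] with the product sigma-algebra, i.e. $E^{\mathbb{N}}$. *)
Definition seq_space {d} (E : measurableType d) :=
  g_sigma_algebraType (cylinders (fun (j : nat) (w : nat -> E) => w j)).

(* ['cV[R]_m] with the sigma-algebra generated by its coordinates, which is the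
   Borel sigma-algebra of $\mathbb{R}^m$. *)
Definition vec_space (R : realType) (m : nat) :=
  g_sigma_algebraType
    (cylinders (fun (c : 'I_m) (v : 'cV[R]_m) => v c 0 : R)).

Definition enorm {R : realType} {m} (v : 'cV[R]_m) : R :=
  Num.sqrt (\sum_c v c 0 ^+ 2).

Section probability_notions.
Context {dT} {T : measurableType dT} {R : realType} (P : probability T R).

Definition Lr_norm {m} (r : R) (U : T -> 'cV[R]_m) : \bar R :=
  Lnorm P r%:E (fun t => (enorm (U t))%:E).

Definition mean_mx {m n} (M : T -> 'M[R]_(m, n)) : 'M[R]_(m, n) :=
  \matrix_(a, b) fine ('E_P[fun t => M t a b])%E.

(* The entrywise $\mathbb{E}\int_0^1 M(u)\,du$. *)
Definition mean_int_mx {m n} (M : R -> T -> 'M[R]_(m, n)) : 'M[R]_(m, n) :=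
  \matrix_(a, b)
    fine ('E_P[fun t => (\int[lebesgue_measure]_(u in `[0, 1]) M u t a b)%R])%E.

Definition mutually_independent {I : eqType} {d} {E : measurableType d}
    (X : I -> T -> E) : Prop :=
  forall (s : seq I) (B : I -> set E), uniq s ->
    (forall i, measurable (B i)) ->
    P (\bigcap_(i in [set` s]) X i @^-1` B i)
    = (\prod_(i <- s) P (X i @^-1` B i))%E.

Record iid {I : eqType} {d} {E : measurableType d} (X : I -> T -> E) : Prop :=
  Iid {
    iid_measurable : forall i, measurable_fun setT (X i);
    iid_same_law : forall i j (B : set E), measurable B ->
      P (X i @^-1` B) = P (X j @^-1` B);
    iid_independent : mutually_independent X }.

Definition measurable_wrt (F : set (set T)) {d} {T' : measurableType d}
    (f : T -> T') : Prop :=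
  forall B : set T', measurable B -> F (f @^-1` B).

(* [Y] is a version of $\mathbb{E}(X\mid F)$, for [X] integrable. *)
Record is_cond_exp (F : set (set T)) (X Y : T -> R) : Prop := IsCondExp {
  cond_exp_integrable_src : P.-integrable setT (EFin \o X);
  cond_exp_integrable : P.-integrable setT (EFin \o Y);
  cond_exp_measurable : measurable_wrt F Y;
  cond_exp_int : forall A, F A ->
    (\int[P]_(t in A) (X t)%:E = \int[P]_(t in A) (Y t)%:E)%E }.

(* The same for [X >= 0], where the integrals may be infinite and no
   integrability is needed. *)
Record is_cond_exp_nonneg (F : set (set T)) (X Y : T -> R) : Prop :=
  IsCondExpNonneg {
    cond_exp_nonneg_src : forall t, 0 <= X t;
    cond_exp_nonneg : forall t, 0 <= Y t;
    cond_exp_nonneg_measurable : measurable_wrt F Y;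
    cond_exp_nonneg_int : forall A, F A ->
      (\int[P]_(t in A) (X t)%:E = \int[P]_(t in A) (Y t)%:E)%E }.

(* [V] is a version of $\mathrm{Var}(X\mid F)$; the unconditional variance of
   [X] may be infinite. *)
Definition is_cond_var (F : set (set T)) (X V : T -> R) : Prop :=
  exists2 M, is_cond_exp F X M &
             is_cond_exp_nonneg F (fun t => (X t - M t) ^+ 2) V.

End probability_notions.

Section dependence.
Context {dT dE} {T : measurableType dT} {E : measurableType dE}.
Context {R : realType} (P : probability T R).

(* $\mathcal{F}_k = (\xi_k, \xi_{k-1}, \ldots)$ as a random element of
   [seq_space E]. *)
Definition past (xi : int -> T -> E) (k : int) (t : T) : nat -> E :=
  fun j => xi (k - j%:Z) t.

Definition past_sigma (xi : int -> T -> E) (k : int) : set (set T) :=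
  g_sigma_algebra_preimage (past xi k : T -> seq_space E).

(* $\mathcal{F}_{0,k}$: the coordinate $\xi_{-k}$ of $\mathcal{F}_0$ is replaced
   by $\xi'_{-k}$. *)
Definition past_coupled (xi xi' : int -> T -> E) (k : nat) (t : T) : nat -> E :=
  fun j => if j == k then xi' (- j%:Z) t else xi (- j%:Z) t.

Definition noise_pair (xi xi' : int -> T -> E) (s : int + int) : T -> E :=
  match s with inl k => xi k | inr k => xi' k end.

Context (xi xi' : int -> T -> E) {m : nat}.
Implicit Type J : nat -> nat -> (nat -> E) -> 'cV[R]_m.

Definition array_sup (f : nat -> nat -> \bar R) : \bar R :=
  ereal_sup [set f ni.1 ni.2 | ni in [set ni : nat * nat |
                                       (1 <= ni.2 <= ni.1)%N]].

Definition dep_delta J (k : nat) (r : R) : \bar R :=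
  array_sup (fun n i => Lr_norm P r (fun t =>
    J n i (past xi 0 t) - J n i (past_coupled xi xi' k t))).

Definition dep_Theta J (k0 : nat) (r : R) : \bar R :=
  (\sum_(k0 <= k <oo) dep_delta J k r)%E.

Definition array_Lr_sup J (r : R) : \bar R :=
  array_sup (fun n i => Lr_norm P r (fun t => J n i (past xi 0 t))).

End dependence.

(* Functions of $u\in[0,1]$ are total on [R]; only their values on [`[0, 1]]
   are constrained or used. Likewise triangular arrays are indexed by all
   [n i : nat] and only $1\le i\le n$ matters. *)
Record regression (R : realType) dT (T : measurableType dT)
    dE (E : measurableType dE) (p1 p2 : nat) := Regression {
  noise : int -> T -> E;
  noise' : int -> T -> E;
  beta1 : 'cV[R]_p1;
  beta2 : R -> 'cV[R]_p2;
  x_fun : nat -> nat -> (nat -> E) -> 'cV[R]_(p1 + p2);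
  e_fun : nat -> nat -> (nat -> E) -> R;
  response : nat -> nat -> T -> R;
  sigma : R -> 'cV[R]_(p1 + p2) -> R;
  x_stat_fun : R -> (nat -> E) -> 'cV[R]_(p1 + p2);
  e_stat_fun : R -> (nat -> E) -> R }.

Section model.
Context {R : realType} {dT dE} {T : measurableType dT} {E : measurableType dE}.
Context (P : probability T R) {p1 p2 : nat} (S : regression R T E p1 p2).
Local Notation d0 := (p1 + p2)%N.
Implicit Types (n : nat) (u : R) (t : T) (p : R -> 'cV[R]_d0 -> R).

Local Notation Fk := (past (noise S)).
Local Notation sFk := (past_sigma (noise S)).
Local Notation time n i := ((i : nat)%:R / (n : nat)%:R : R).

Definition x_arr n (i : nat) t : 'cV[R]_d0 := x_fun S n i (Fk i t).
Definition e_arr n (i : nat) t : R := e_fun S n i (Fk i t).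

Definition x_stat u (i : int) t : 'cV[R]_d0 := x_stat_fun S u (Fk i t).
Definition e_stat u (i : int) t : R := e_stat_fun S u (Fk i t).
Definition x1_stat u i t : 'cV[R]_p1 := usubmx (x_stat u i t).
Definition x2_stat u i t : 'cV[R]_p2 := dsubmx (x_stat u i t).
Definition sigma_stat u i t : R := sigma S u (x_stat u i t).

Record regression_model : Prop := RegressionModel {
  (* the $\xi_k$ are i.i.d. and $\xi'$ is an independent copy of $\xi$ *)
  noise_iid : iid P (noise_pair (noise S) (noise' S));
  beta2_lipschitz : [lipschitz (beta2 S u) | u in (`[0, 1] : set R^o)];
  x_fun_measurable : forall n i, (1 <= i <= n)%N ->
    measurable_fun setT (x_fun S n i : seq_space E -> vec_space R d0);
  e_fun_measurable : forall n i, (1 <= i <= n)%N ->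
    measurable_fun setT (e_fun S n i : seq_space E -> R);
  sigma_measurable : measurable_fun
    (`[0, 1]%classic `*` setT : set (R * vec_space R d0))
    (fun uv : R * vec_space R d0 => sigma S uv.1 uv.2);
  sigma_gt0 : forall u v, u \in `[0, 1] -> 0 < sigma S u v;
  response_eq : forall n i t, (1 <= i <= n)%N ->
    response S n i t = ((usubmx (x_arr n i t))^T *m beta1 S) 0 0
              + ((dsubmx (x_arr n i t))^T *m beta2 S (time n i)) 0 0
              + e_arr n i t;
  x_arr_predictable : forall n i, (1 <= i <= n)%N ->
    measurable_wrt (sFk (i%:Z - 1)) (x_arr n i : T -> vec_space R d0);
  e_arr_mds : forall n i, (1 <= i <= n)%N ->
    is_cond_exp P (sFk (i%:Z - 1)) (e_arr n i) (cst 0);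
  e_arr_var : forall n i, (1 <= i <= n)%N ->
    is_cond_var P (sFk (i%:Z - 1)) (e_arr n i)
      (fun t => sigma S (time n i) (x_arr n i t) ^+ 2);
  (* jointly measurable in [u], so that the integrals over [u] make sense *)
  x_stat_fun_measurable : measurable_fun
    (`[0, 1]%classic `*` setT : set (R * seq_space E))
    ((fun uw => x_stat_fun S uw.1 uw.2) : R * seq_space E -> vec_space R d0);
  e_stat_fun_measurable : forall u, u \in `[0, 1] ->
    measurable_fun setT (e_stat_fun S u : seq_space E -> R);
  x_stat_predictable : forall u (i : int), u \in `[0, 1] ->
    measurable_wrt (sFk (i - 1)) (x_stat u i : T -> vec_space R d0);
  e_stat_mds : forall u (i : int), u \in `[0, 1] ->
    is_cond_exp P (sFk (i - 1)) (e_stat u i) (cst 0);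
  e_stat_var : forall u (i : int), u \in `[0, 1] ->
    is_cond_var P (sFk (i - 1)) (e_stat u i)
      (fun t => sigma_stat u i t ^+ 2) }.

(* The array of functions defining $X_i = p_i x_i$, resp. $X_i\varepsilon_i$. *)
Definition X_fun p n (i : nat) (w : nat -> E) : 'cV[R]_d0 :=
  p (time n i) (x_fun S n i w) *: x_fun S n i w.
Definition Xeps_fun p n (i : nat) (w : nat -> E) : 'cV[R]_d0 :=
  (p (time n i) (x_fun S n i w) * e_fun S n i w) *: X_fun p n i w.

Definition X_arr p n (i : nat) t : 'cV[R]_d0 := X_fun p n i (Fk i t).
Definition Xeps_arr p n (i : nat) t : 'cV[R]_d0 := Xeps_fun p n i (Fk i t).

Definition p_stat p u (i : int) t : R := p u (x_stat u i t).
Definition X_stat p u (i : int) t : 'cV[R]_d0 := p_stat p u i t *: x_stat u i t.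
Definition Xeps_stat p u (i : int) t : 'cV[R]_d0 :=
  (p_stat p u i t * e_stat u i t) *: X_stat p u i t.

Record weighted_assumptions p : Prop := WeightedAssumptions {
  weight_measurable : measurable_fun
    (`[0, 1]%classic `*` setT : set (R * vec_space R d0))
    (fun uv : R * vec_space R d0 => p uv.1 uv.2);
  approximation : exists C : R, \forall n \near \oo,
    forall i, (1 <= i <= n)%N ->
      (Lr_norm P 2%R (fun t => X_arr p n i t - X_stat p (time n i) i t)%R
       + Lr_norm P 2%R (fun t =>
           Xeps_arr p n i t - Xeps_stat p (time n i) i t)%R
       <= (C / n%:R)%:E)%E;
  time_lipschitz : exists2 C : R, 0 < C &
    forall (i : int) (u v : R), u \in `[0, 1] -> v \in `[0, 1] ->
      (Lr_norm P 2%R (fun t => X_stat p u i t - X_stat p v i t)%R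
       + Lr_norm P 2%R (fun t => Xeps_stat p u i t - Xeps_stat p v i t)%R
       <= (C * `|u - v|)%:E)%E;
  weak_dependence : exists q q1 q2 : R,
    [/\ 8 / 7 < q, 16 / 7 < q1, 2 < q2 & 1 / q = 1 / q1 + 1 / q2] /\
    [/\ (dep_Theta P (noise S) (noise' S) (X_fun p) 0 (2 * q1)%R
         + dep_Theta P (noise S) (noise' S) (Xeps_fun p) 0 q2 < +oo)%E,
        (array_Lr_sup P (noise S) (X_fun p) (2 * q1)%R < +oo)%E &
        (array_Lr_sup P (noise S) (Xeps_fun p) q2 < +oo)%E];
  gram_nonsingular : forall (i : int) u, u \in `[0, 1] ->
    \det (mean_mx P (fun t => X_stat p u i t *m (X_stat p u i t)^T)) != 0 }.

Definition q_proj p u (i : int) : 'M[R]_(p2, p1) :=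
  invmx (mean_mx P (fun t =>
    p_stat p u i t ^+ 2 *: (x2_stat u i t *m (x2_stat u i t)^T)))
  *m mean_mx P (fun t =>
    p_stat p u i t ^+ 2 *: (x2_stat u i t *m (x1_stat u i t)^T)).

Definition x1_tilde p u (i : int) t : 'cV[R]_p1 :=
  x1_stat u i t - (q_proj p u i)^T *m x2_stat u i t.

Definition Sigma1 p (i : int) : 'M[R]_p1 := mean_int_mx P (fun u t =>
  p_stat p u i t ^+ 2 *: (x1_tilde p u i t *m (x1_tilde p u i t)^T)).

Definition Sigma2 p (i : int) : 'M[R]_p1 := mean_int_mx P (fun u t =>
  (p_stat p u i t ^+ 4 * sigma_stat u i t ^+ 2)
    *: (x1_tilde p u i t *m (x1_tilde p u i t)^T)).

Definition q_proj_star u (i : int) : 'M[R]_(p2, p1) :=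
  invmx (mean_mx P (fun t =>
    (sigma_stat u i t) ^- 2 *: (x2_stat u i t *m (x2_stat u i t)^T)))
  *m mean_mx P (fun t =>
    (sigma_stat u i t) ^- 2 *: (x2_stat u i t *m (x1_stat u i t)^T)).

Definition x1_tilde_star u (i : int) t : 'cV[R]_p1 :=
  x1_stat u i t - (q_proj_star u i)^T *m x2_stat u i t.

Definition Sigma_star (i : int) : 'M[R]_p1 := mean_int_mx P (fun u t =>
  (sigma_stat u i t) ^- 2
    *: (x1_tilde_star u i t *m (x1_tilde_star u i t)^T)).

Definition inv_sigma u (v : 'cV[R]_d0) : R := (sigma S u v)^-1.

End model.

(* Main.v *)
Require Import Defs.
From HB Require Import structures.
From mathcomp Require Import all_boot all_order all_algebra.
From mathcomp Require Import all_classical all_reals all_analysis.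
From mathcomp Require Import measurable_realfun ring lra.
Set Implicit Arguments.
Unset Strict Implicit.
Unset Printing Implicit Defensive.
Import Order.TTheory GRing.Theory Num.Theory.
Import numFieldNormedType.Exports.
Local Open Scope classical_set_scope.
Local Open Scope ring_scope.

(** The inequality is the Gauss-Markov phenomenon: it expresses that a square
    in $L^2([0,1] \times \Omega)$ is nonnegative.  Write $p$, $\sigma$ for
    $p(u, x(u))$, $\sigma(u, x(u))$, and consider, under the product of the
    uniform law on $[0,1]$ with $P$, the random vectors
    $A = p^2 \sigma \widetilde x_1$ and $B = \sigma^{-1} \widetilde x_1^\ast$.
    Then $\Sigma_2 = E A A'$ and $\Sigma^\ast = E B B'$, while
    $E A B' = E p^2 \widetilde x_1 (\widetilde x_1^\ast)'$ equals $\Sigma_1$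
    ([gram_cross]): $\widetilde x_1^\ast$ and $\widetilde x_1$ differ by
    $r(u)' x_2$ with $r$ deterministic, and by the normal equations
    $p \widetilde x_1$ is orthogonal to $p x_2$ at every $u$
    ([normal_equation], [gram_residual_change]).  With
    $v = \Sigma_1^{-1} z$ and $w = (\Sigma^\ast)^{-1} z$, expanding
    $0 \le E (v'A - w'B)^2$ gives the inequality ([gram_sandwich_ge]).  For
    $p = \sigma^{-1}$ the integrands of $\Sigma_1$, $\Sigma_2$ and $\Sigma^\ast$
    are the same, whence the equality.

    $\Sigma_1$ is invertible because $z' \Sigma_1 z = 0$ forces, for almost
    every $u$, the linear relation with coefficients $(z, - q_2(u) z)$ between
    the coordinates of $X(u)$, and $\det E X(u) X(u)' \ne 0$ excludes it
    unless $z = 0$ ([gram_residual_unit]).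

    The rest of the proof makes these computations legitimate: the matrices
    are iterated integrals, so every factor has to be jointly measurable and
    square-integrable on the product space.  The second moments of $X(u)$ and
    $X(u) \varepsilon(u)$ are bounded uniformly in $u$
    ([stationary_L2_bound]): the moment bound for the triangular array at time
    $0$ passes to time $1$ by stationarity, to the approximation at
    $u = 1/n$ because it is $L^2$-close to the array, and to all $u$ by the
    Lipschitz condition.  Conditioning on the past turns
    $E |X \varepsilon|^2$ into $E p^4 \sigma^2 |x|^2$, which controls
    $\Sigma_2$ ([cond_var_mds], [ge0_integral_mul_transfer]).  Finally
    $q_2(u)$ is bounded, since it is a continuous function of the Gram matrix
    of $X(u)$, which is Lipschitz in $u$ ([bounded_q_field]).  Time $u$ is
    clamped to $[0,1]$ throughout, so that all processes become functions on
    the whole real line to which the global forms of continuity and of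
    Fubini's theorem apply. *)

(** * Square-integrable functions and Gram matrices *)

Section square_integrable.
Context {d} {T : measurableType d} {R : realType}.
Variable mu : {measure set T -> \bar R}.
Implicit Types f g : T -> R.

Definition sqint f :=
  measurable_fun setT f /\ mu.-integrable setT (EFin \o (fun x => f x ^+ 2)).

(** Domination up to a constant; every closure property below whose factor is
    bounded reduces to it. *)
Lemma le_sqint (k : R) f g : measurable_fun setT f -> sqint g ->
  (forall x, f x ^+ 2 <= k * g x ^+ 2) -> sqint f.
Proof.
move=> mf [mg ig] fg; split => //.
apply: (@le_integrable _ _ _ mu setT _ _ (fun x => k%:E * (g x ^+ 2)%:E)%E) => //.
- by apply/measurable_EFinP; exact: measurable_funX.
- move=> x _ /=; rewrite lee_fin ger0_norm ?sqr_ge0// (le_trans (fg x))//.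
  exact: ler_norm.
- exact: integrableZl.
Qed.

Lemma integrable_mul_sqint f g : sqint f -> sqint g ->
  mu.-integrable setT (EFin \o (fun x => f x * g x)).
Proof.
move=> [mf if2] [mg ig2].
apply: (@le_integrable _ _ _ mu setT _ _
  (fun x => (f x ^+ 2)%:E + (g x ^+ 2)%:E)%E) => //; last exact: integrableD.
- by apply/measurable_EFinP; exact: measurable_funM.
- move=> x _ /=; rewrite lee_fin [leRHS]ger0_norm ?addr_ge0 ?sqr_ge0//.
  by rewrite ler_norml; apply/andP; split; nra.
Qed.

Lemma sqintZ (k : R) f : sqint f -> sqint (fun x => k * f x).
Proof.
move=> /[dup] sf [mf _]; apply: (@le_sqint (k ^+ 2) _ f) => //.
- exact: measurable_funM.
- by move=> x; rewrite exprMn.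
Qed.

Lemma sqintD f g : sqint f -> sqint g -> sqint (fun x => f x + g x).
Proof.
move=> /[dup] sf [mf if2] /[dup] sg [mg ig2].
have mD : measurable_fun setT (fun x => f x + g x) by exact: measurable_funD.
split => //.
have ifg := integrable_mul_sqint sf sg.
rewrite [X in integrable _ _ X](_ : _ = (fun x => (f x ^+ 2)%:E +
  (2%:E * (f x * g x)%:E + (g x ^+ 2)%:E))%E).
  by apply: integrableD => //; apply: integrableD => //; exact: integrableZl.
by apply/funext => x /=; rewrite -!EFinM -!EFinD; congr EFin; ring.
Qed.

Lemma sqintB f g : sqint f -> sqint g -> sqint (fun x => f x - g x).
Proof.
move=> sf /(sqintZ (-1)) sg; have := sqintD sf sg.
by under eq_fun do rewrite mulN1r.
Qed.

Lemma sqint_sum (I : Type) (s : seq I) (F : I -> T -> R) :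
  (forall a, sqint (F a)) -> sqint (fun x => \sum_(a <- s) F a x).
Proof.
move=> sF; elim: s => [|a s IH].
  under eq_fun do rewrite big_nil.
  split; first exact: measurable_cst.
  rewrite [X in integrable _ _ X](_ : _ = cst 0%E); first exact: integrable0.
  by apply/funext => x /=; rewrite expr0n.
by under eq_fun do rewrite big_cons; exact: sqintD.
Qed.

Lemma sqint_bounded_mul (b f : T -> R) (k : R) :
  measurable_fun setT b -> (forall x, `|b x| <= k) -> sqint f ->
  sqint (fun x => b x * f x).
Proof.
move=> mb bk /[dup] sf [mf _]; apply: (@le_sqint (k ^+ 2) _ f) => //.
- exact: measurable_funM.
- move=> x; rewrite exprMn ler_wpM2r ?sqr_ge0// -(real_normK (num_real (b x))).
  by rewrite lerXn2r// nnegrE ?(le_trans _ (bk x)).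
Qed.

Lemma RintegralZl_mul (k : R) f g : sqint f -> sqint g ->
  \int[mu]_x (k * (f x * g x)) = k * \int[mu]_x (f x * g x).
Proof. by move=> sf sg; rewrite RintegralZl//; exact: integrable_mul_sqint. Qed.

End square_integrable.

Section gram.
Context {d} {T : measurableType d} {R : realType}.
Variable mu : {measure set T -> \bar R}.

Definition gram {m n} (A : 'I_m -> T -> R) (B : 'I_n -> T -> R) : 'M[R]_(m, n) :=
  \matrix_(a, b) \int[mu]_x (A a x * B b x).

Definition lincomb {m} (v : 'cV[R]_m) (A : 'I_m -> T -> R) (x : T) : R :=
  \sum_a v a 0 * A a x.

Lemma sqint_lincomb {m} (v : 'cV[R]_m) (A : 'I_m -> T -> R) :
  (forall a, sqint mu (A a)) -> sqint mu (lincomb v A).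
Proof. by move=> sA; apply: sqint_sum => a; exact: sqintZ. Qed.

Lemma tr_gram {m n} (A : 'I_m -> T -> R) (B : 'I_n -> T -> R) :
  (gram A B)^T = gram B A.
Proof.
by apply/matrixP => a b; rewrite !mxE; apply: eq_Rintegral => x _; rewrite mulrC.
Qed.


Lemma Rintegral_mul_lincomb {n} (w : 'cV[R]_n) (f : T -> R)
    (B : 'I_n -> T -> R) : sqint mu f -> (forall b, sqint mu (B b)) ->
  \int[mu]_x (f x * lincomb w B x) =
  \sum_b w b 0 * \int[mu]_x (f x * B b x).
Proof.
move=> sf sB; rewrite /lincomb; elim: (index_enum _) => [|b s IH].
  rewrite big_nil /Rintegral.
  by under eq_integral do rewrite big_nil mulr0; rewrite integral0.
rewrite big_cons -IH -RintegralZl_mul// -RintegralD//.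
- by apply: eq_Rintegral => x _; rewrite big_cons; ring.
- rewrite (_ : _ \o _ = fun x => ((w b 0)%:E * (f x * B b x)%:E)%E)//.
  by apply: integrableZl => //; exact: integrable_mul_sqint.
- apply: integrable_mul_sqint => //; apply: sqint_sum => c.
  exact: sqintZ.
Qed.

Lemma gram_bilinear {m n} (A : 'I_m -> T -> R) (B : 'I_n -> T -> R)
    (v : 'cV[R]_m) (w : 'cV[R]_n) :
  (forall a, sqint mu (A a)) -> (forall b, sqint mu (B b)) ->
  (v^T *m gram A B *m w) 0 0 = \int[mu]_x (lincomb v A x * lincomb w B x).
Proof.
move=> sA sB; rewrite Rintegral_mul_lincomb//; last exact: sqint_lincomb.
rewrite mxE; apply: eq_bigr => b _; rewrite mulrC; congr (_ * _).
under eq_Rintegral do rewrite mulrC.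
rewrite Rintegral_mul_lincomb// mxE; apply: eq_bigr => a _.
by rewrite !mxE; congr (_ * _); apply: eq_Rintegral => x _; rewrite mulrC.
Qed.

Lemma sqint_eq0 (f : T -> R) : sqint mu f -> \int[mu]_x (f x * f x) = 0 ->
  {ae mu, forall x, f x = 0}.
Proof.
move=> sf; have ff := integrable_mul_sqint sf sf.
have mff : measurable_fun setT (fun x => (f x * f x)%:E) by case/integrableP: ff.
move=> /eqP; rewrite /Rintegral fine_eq0; last exact: integrable_fin_num ff.
move/eqP => f0.
have : (\int[mu]_x `|(f x * f x)%:E| = 0)%E.
  by under eq_integral do rewrite gee0_abs ?lee_fin -?expr2 ?sqr_ge0//=.
move/(ae_eq_integral_abs _ measurableT mff).
by apply: filterS => x /= /(_ I) [] /eqP; rewrite mulf_eq0 orbb => /eqP.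
Qed.

(** A combination of null norm vanishes almost everywhere, hence is orthogonal
    to everything: a null vector of the quadratic form lies in the kernel. *)
Lemma gram_null_lincomb {m n} (A : 'I_m -> T -> R) (B : 'I_n -> T -> R)
    (v : 'cV[R]_m) :
  (forall a, sqint mu (A a)) -> (forall b, sqint mu (B b)) ->
  \int[mu]_x (lincomb v A x * lincomb v A x) = 0 -> v^T *m gram A B = 0.
Proof.
move=> sA sB /(sqint_eq0 (sqint_lincomb v sA)) v0.
apply/rowP => b; rewrite [RHS]mxE mxE.
transitivity (\int[mu]_x (B b x * lincomb v A x)).
  rewrite Rintegral_mul_lincomb//; apply: eq_bigr => a _.
  by rewrite !mxE; congr (_ * _); apply: eq_Rintegral => x _; rewrite mulrC.
rewrite /Rintegral (ae_eq_integral (cst 0%E))//.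
- by rewrite integral0.
- by apply/measurable_EFinP; apply: measurable_funM;
    [case: (sB b)|case: (sqint_lincomb v sA)].
- by apply: filterS v0 => x /= -> _; rewrite mulr0.
Qed.

Lemma gram_unit_definite {m} (A : 'I_m -> T -> R) (v : 'cV[R]_m) :
  (forall a, sqint mu (A a)) -> gram A A \in unitmx ->
  \int[mu]_x (lincomb v A x * lincomb v A x) = 0 -> v = 0.
Proof.
move=> sA uA /(gram_null_lincomb sA sA) vG.
apply: trmx_inj; rewrite trmx0 -[LHS]mulmx1 -(mulmxV uA) mulmxA vG.
by rewrite mul0mx.
Qed.

Lemma definite_gram_unit {m} (A : 'I_m -> T -> R) :
  (forall a, sqint mu (A a)) ->
  (forall v : 'cV[R]_m,
     \int[mu]_x (lincomb v A x * lincomb v A x) = 0 -> v = 0) ->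
  gram A A \in unitmx.
Proof.
move=> sA Adef; rewrite unitmxE unitfE; apply/negP => /det0P[v v0 vG].
move/negP: v0; apply; apply/eqP/trmx_inj; rewrite trmx0; apply: Adef.
by rewrite -gram_bilinear// trmxK vG mul0mx mxE.
Qed.

(** With $v = (E A B')^{-1} z$ and $w = (E B B')^{-1} z$, both
    $v' (E A B') w$ and $w' (E B B') w$ equal the left-hand side and
    $v' (E A A') v$ is the right-hand side, so the inequality is
    $E (v'A - w'B)^2 \ge 0$. *)
Lemma gram_sandwich_ge {m} (A B : 'I_m -> T -> R) (z : 'cV[R]_m) :
  (forall a, sqint mu (A a)) -> (forall b, sqint mu (B b)) ->
  gram A B \in unitmx -> (gram A B)^T = gram A B ->
  gram B B \in unitmx ->
  (z^T *m invmx (gram B B) *m z) 0 0 <=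
  (z^T *m (invmx (gram A B) *m gram A A *m invmx (gram A B)) *m z) 0 0.
Proof.
move=> sA sB uAB symAB uBB.
set v : 'cV_m := invmx (gram A B) *m z; set w : 'cV_m := invmx (gram B B) *m z.
have vT : v^T = z^T *m invmx (gram A B) by rewrite trmx_mul trmx_inv symAB.
have wT : w^T = z^T *m invmx (gram B B) by rewrite trmx_mul trmx_inv tr_gram.
have sv := sqint_lincomb v sA; have sw := sqint_lincomb w sB.
have ivv := integrable_mul_sqint sv sv.
have ivw := integrable_mul_sqint sv sw.
have iww := integrable_mul_sqint sw sw.
have vv := gram_bilinear v v sA sA; have vw := gram_bilinear v w sA sB.
have ww := gram_bilinear w w sB sB.
rewrite wT -!mulmxA (mulmxA (gram B B)) mulmxV// mul1mx in ww.
rewrite vT -!mulmxA (mulmxA (invmx (gram A B)) (gram A B)) mulVmx// mul1mx in vw.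
rewrite vT {1}/v !mulmxA in vv; rewrite !mulmxA vv.
rewrite !mulmxA in vw ww.
suff : 0 <= \int[mu]_x (lincomb v A x * lincomb v A x)
   - \int[mu]_x (lincomb v A x * lincomb w B x) *+ 2
   + \int[mu]_x (lincomb w B x * lincomb w B x).
  by rewrite -ww -vw mulr2n; set a := _ 0 0; set b := \int[mu]_x _; lra.
have := @Rintegral_ge0 _ _ _ mu setT (fun x =>
  (lincomb v A x - lincomb w B x) ^+ 2) (fun x _ => sqr_ge0 _).
rewrite (_ : (fun x => _ ^+ 2) = fun x => lincomb v A x * lincomb v A x
   + (- 2 * (lincomb v A x * lincomb w B x)
   + lincomb w B x * lincomb w B x)); last by apply/funext => x; ring.
have i2 : mu.-integrable setT
    (EFin \o (fun x => - 2 * (lincomb v A x * lincomb w B x))).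
  rewrite (_ : _ \o _ = fun x => ((- 2)%:E * (lincomb v A x * lincomb w B x)%:E)%E)//.
  exact: integrableZl.
rewrite RintegralD//; last first.
  exact: (@integrableD _ _ _ mu setT measurableT _ _ i2 iww).
rewrite RintegralD// RintegralZl//.
by set a := \int[mu]_x _; set b := \int[mu]_x _; set c := \int[mu]_x _; lra.
Qed.

End gram.

(** * Residuals of a partial regression *)

Section residual.
Context {V : Type} {R : realType} {p1 p2 : nat}.

(** $x_1 - r' x_2$, where the block $x_1$ is the first [p1] coordinates of
    [X] and $x_2$ the last [p2]. *)
Definition residual (r : V -> 'M[R]_(p2, p1)) (X : 'I_(p1 + p2) -> V -> R)
    (a : 'I_p1) (x : V) : R :=
  X (lshift p2 a) x - \sum_k r x k a * X (rshift p1 k) x.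

Lemma residual_mul (r : V -> 'M[R]_(p2, p1)) (g : V -> R) X a x :
  residual r (fun b y => g y * X b y) a x = g x * residual r X a x.
Proof.
rewrite /residual mulrBr mulr_sumr; congr (_ - _).
by apply: eq_bigr => k _; ring.
Qed.

Lemma residual_change (q r : V -> 'M[R]_(p2, p1)) X a x :
  residual r X a x =
  residual q X a x + \sum_k (q x k a - r x k a) * X (rshift p1 k) x.
Proof.
rewrite /residual -addrA; congr (_ + _); rewrite -!sumrN -big_split/=.
by apply: eq_bigr => k _; ring.
Qed.

End residual.

Section normal_equations.
Context {d} {T : measurableType d} {R : realType} {p1 p2 : nat}.
Variable mu : {measure set T -> \bar R}.
Variable X : 'I_(p1 + p2) -> T -> R.
Hypothesis sX : forall a, sqint mu (X a).

Let G := gram mu X X.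

(** A combination of residuals is a combination of the original coordinates
    whose first block is the same; this is how nondegeneracy of [X] reaches
    the residuals. *)
Lemma lincomb_residual (q : 'M[R]_(p2, p1)) (v : 'cV[R]_p1) x :
  lincomb v (residual (cst q) X) x = lincomb (col_mx v (- (q *m v))) X x.
Proof.
rewrite /lincomb big_split_ord/=.
under eq_bigr do rewrite mulrBr mulr_sumr.
rewrite sumrB; congr (_ + _).
  by apply: eq_bigr => a _; rewrite col_mxEu.
rewrite exchange_big/= -sumrN; apply: eq_bigr => k _.
rewrite col_mxEd !mxE mulNr mulr_suml; congr (- _).
by apply: eq_bigr => a _; ring.
Qed.

(** A relation between the coordinates of the second block is one between all
    coordinates, so the nondegeneracy of the whole family is inherited. *)
Lemma gram_drsub_unit : G \in unitmx -> drsubmx G \in unitmx.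
Proof.
move=> uG; rewrite (_ : drsubmx G =
    gram mu (fun k => X (rshift p1 k)) (fun k => X (rshift p1 k))); last first.
  by apply/matrixP => a b; rewrite !mxE.
apply: definite_gram_unit => [k|v v0]; first exact: sX.
have : col_mx (0 : 'cV[R]_p1) v = 0.
  apply: (gram_unit_definite sX uG); rewrite -[RHS]v0; apply: eq_Rintegral => x _.
  suff -> : lincomb (col_mx 0 v) X x = lincomb v (fun k => X (rshift p1 k)) x by [].
  rewrite /lincomb big_split_ord/= big1 ?add0r => [|a _].
    by apply: eq_bigr => k _; rewrite col_mxEd.
  by rewrite col_mxEu mxE mul0r.
by move/(congr1 dsubmx); rewrite col_mxKd linear0.
Qed.

Lemma sqint_residual_cst (q : 'M[R]_(p2, p1)) a :
  sqint mu (residual (cst q) X a).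
Proof.
by apply: sqintB => //; apply: sqint_sum => k; exact: sqintZ.
Qed.

(** $E x_2 x_1' - E x_2 x_2' \, q = 0$ for the least-squares coefficient
    $q = (E x_2 x_2')^{-1} E x_2 x_1'$. *)
Lemma normal_equation a k : G \in unitmx ->
  \int[mu]_x (residual (cst (invmx (drsubmx G) *m dlsubmx G)) X a x
              * X (rshift p1 k) x) = 0.
Proof.
move=> uG; set q := _ *m _; have u22 := gram_drsub_unit uG.
transitivity ((dlsubmx G - drsubmx G *m q) k a); last first.
  by rewrite mulmxA mulmxV// mul1mx subrr mxE.
transitivity (\int[mu]_x (X (rshift p1 k) x * X (lshift p2 a) x) -
   \int[mu]_x (X (rshift p1 k) x * lincomb (col a q) (fun j => X (rshift p1 j)) x)).
  rewrite -RintegralB//.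
  - apply: eq_Rintegral => x _; rewrite /residual mulrC mulrBr; congr (_ - _ * _).
    by apply: eq_bigr => j _; rewrite [in RHS]mxE.
  - exact: integrable_mul_sqint.
  - by apply: integrable_mul_sqint => //; apply: sqint_lincomb.
rewrite Rintegral_mul_lincomb//; rewrite !mxE; congr (_ - _).
by apply: eq_bigr => j _; rewrite !mxE mulrC.
Qed.

End normal_equations.

Section random_field.
Context {d1 d2} {T1 : measurableType d1} {T2 : measurableType d2}.
Context {R : realType} {p1 p2 : nat}.
Variables (P1 : probability T1 R) (P2 : probability T2 R).
Local Notation Q := (P1 \x P2)%E.
Variable X : 'I_(p1 + p2) -> T1 * T2 -> R.
Hypothesis sX : forall a, sqint Q (X a).
Hypothesis sXu : forall u a, sqint P2 (fun t => X a (u, t)).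
Let G u := gram P2 (fun a t => X a (u, t)) (fun a t => X a (u, t)).
Hypothesis uG : forall u, G u \in unitmx.
Let q u := invmx (drsubmx (G u)) *m dlsubmx (G u).

(** Coefficients that preserve square-integrability on the product space. *)
Definition bounded_coef (r : T1 -> 'M[R]_(p2, p1)) := forall k a,
  measurable_fun setT (fun u => r u k a) /\
  exists M, forall u, `|r u k a| <= M.

Lemma sqint_residual (Y : 'I_(p1 + p2) -> T1 * T2 -> R) r a :
  bounded_coef r -> (forall a, sqint Q (Y a)) ->
  sqint Q (residual (r \o fst) Y a).
Proof.
move=> br sY; apply: sqintB => //; apply: sqint_sum => k.
have [mr [M rM]] := br k a.
apply: (@sqint_bounded_mul _ _ _ _ (fun x : T1 * T2 => r x.1 k a) _ M) => //.
exact: (measurableT_comp mr).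
Qed.

Hypothesis bq : bounded_coef q.


(** By Fubini, integrate over the second space first: there [r] is constant and
    the normal equation applies. *)
Lemma residual_orthogonal (r : T1 -> R) a k : measurable_fun setT r ->
  (exists M, forall u, `|r u| <= M) ->
  \int[Q]_x (residual (q \o fst) X a x * (r x.1 * X (rshift p1 k) x)) = 0.
Proof.
move=> mr [M rM].
have srX : sqint Q (fun x : T1 * T2 => r x.1 * X (rshift p1 k) x).
  apply: (@sqint_bounded_mul _ _ _ _ (fun x : T1 * T2 => r x.1) _ M) => //.
  exact: (measurableT_comp mr).
have int := integrable_mul_sqint (sqint_residual a bq sX) srX.
rewrite /Rintegral -(integral12_prod_meas1 int) /fubini_F.
rewrite (eq_integral (cst 0%E)) ?integral0// => u _ /=.
have sr := sqint_residual_cst (sXu u) (q u) a.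
have i0 := integrable_mul_sqint sr (sXu u (rshift p1 k)).
apply/eqP; rewrite -fine_eq0; last first.
  apply: (integrable_fin_num (measurableT)) => //.
  rewrite (_ : (fun y => _) = fun t => ((r u)%:E *
    (residual (cst (q u)) (fun b t => X b (u, t)) a t
     * X (rshift p1 k) (u, t))%:E)%E).
    exact: integrableZl.
  by apply/funext => t; rewrite -EFinM mulrCA.
apply/eqP; transitivity (\int[P2]_t (r u *
    (residual (cst (q u)) (fun b t => X b (u, t)) a t
     * X (rshift p1 k) (u, t)))).
  by apply: eq_Rintegral => t _; rewrite mulrCA.
rewrite (RintegralZl_mul (r u) sr (sXu u (rshift p1 k))).
by rewrite [X in _ * X](normal_equation (sXu u) a k (uG u)) mulr0.
Qed.

(** The residuals for $r$ and $q$ differ by $(q - r)' x_2$, which is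
    orthogonal to the least-squares residuals. *)
Lemma gram_residual_change r : bounded_coef r ->
  gram Q (residual (q \o fst) X) (residual (r \o fst) X) =
  gram Q (residual (q \o fst) X) (residual (q \o fst) X).
Proof.
move=> br; apply/matrixP => a b; rewrite !mxE.
have sq c := sqint_residual c bq sX.
have sk k : sqint Q (fun x : T1 * T2 => (q x.1 k b - r x.1 k b) * X (rshift p1 k) x).
  have [mq [M qM]] := bq k b; have [mr [N rN]] := br k b.
  apply: (@sqint_bounded_mul _ _ _ _
    (fun x : T1 * T2 => q x.1 k b - r x.1 k b) _ (M + N)) => //.
    by apply: measurable_funB; [exact: (measurableT_comp mq)|
                                exact: (measurableT_comp mr)].
  by move=> x; rewrite (le_trans (ler_normB _ _))// lerD.
transitivity (\int[Q]_x (residual (q \o fst) X a x * residual (q \o fst) X b x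
   + residual (q \o fst) X a x * lincomb (const_mx 1)
     (fun k (x : T1 * T2) => (q x.1 k b - r x.1 k b) * X (rshift p1 k) x) x)).
  apply: eq_Rintegral => x _; rewrite (residual_change (q \o fst) (r \o fst)).
  rewrite mulrDr; congr (_ + _ * _).
  by apply: eq_bigr => k _; rewrite [const_mx _ _ _]mxE mul1r.
rewrite RintegralD//; last 2 first.
- exact: integrable_mul_sqint.
- by apply: integrable_mul_sqint => //; exact: sqint_lincomb.
rewrite Rintegral_mul_lincomb// big1 ?addr0// => k _.
rewrite [const_mx _ _ _]mxE mul1r (@residual_orthogonal (fun u => q u k b - r u k b))//.
  by apply: measurable_funB; [case: (bq k b)|case: (br k b)].
have [_ [M qM]] := bq k b; have [_ [N rN]] := br k b.
by exists (M + N) => u; rewrite (le_trans (ler_normB _ _))// lerD.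
Qed.

(** A null combination $v$ of the residuals on the product space is null in
    the second space for almost every, hence for some, $u$; there it reads as
    the relation $(v, - q(u) v)$ between the coordinates of $X(u)$. *)
Lemma gram_residual_unit :
  gram Q (residual (q \o fst) X) (residual (q \o fst) X) \in unitmx.
Proof.
have sq c := sqint_residual c bq sX.
apply: definite_gram_unit => // v v0.
have sv := sqint_lincomb v sq.
have iv := integrable_mul_sqint sv sv.
have : (\int[P1]_u \int[P2]_t
    (lincomb v (residual (q \o fst) X) (u, t) *
     lincomb v (residual (q \o fst) X) (u, t))%:E = 0)%E.
  rewrite (integral12_prod_meas1 iv); apply/eqP.
  by rewrite -fine_eq0 ?integrable_fin_num//; exact/eqP.
set F := (X in (\int[_]_u X u)%E) => F0.
have F_ge0 u : (0 <= F u)%E.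
  by apply: integral_ge0 => t _; rewrite lee_fin -expr2 sqr_ge0.
have mF : measurable_fun setT F by exact: (measurable_fubini_F iv).
have : (\int[P1]_u `|F u| = 0)%E.
  by under eq_integral do rewrite gee0_abs//.
move/(ae_eq_integral_abs _ measurableT mF) => aeF.
have pf : ProperFilter (almost_everywhere P1).
  apply: ae_properfilter_algebraOfSetsType.
  by rewrite [X in (_ < X)%E](probability_setT P1) lte01.
(* An almost sure property holds at some time. *)
have [u /(_ I) Fu] := @filter_ex _ _ pf _ aeF.
have : col_mx v (- (q u *m v)) = 0.
  apply: (gram_unit_definite (sXu u) (uG u)).
  rewrite -[RHS](congr1 fine Fu); apply: eq_Rintegral => t _.
  by rewrite -lincomb_residual.
by move/(congr1 usubmx); rewrite col_mxKu linear0.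
Qed.

End random_field.

(** * Integration over the unit interval *)

Section unit_interval.
Context {R : realType}.

(** Composition with this retraction onto $[0,1]$ turns functions controlled
    only on $[0,1]$ into total functions with the same properties. *)
Definition clamp (u : R) : R := Order.max 0 (Order.min u 1).

Lemma clamp_itv u : clamp u \in `[0, 1].
Proof. by rewrite in_itv/= /clamp le_max lexx/= ge_max ler01/= ge_min lexx orbT. Qed.

Lemma clamp_id u : u \in `[0, 1] -> clamp u = u.
Proof.
by rewrite in_itv/= /clamp => /andP[u0 u1]; rewrite min_l// max_r.
Qed.

(** The retraction is affine with slope 0 or 1 on each of three pieces, so it
    does not increase distances. *)
Lemma clamp_dist u v : `|clamp u - clamp v| <= `|u - v|.
Proof.
have cases w : [\/ w <= 0 /\ clamp w = 0, clamp w = w | 1 <= w /\ clamp w = 1].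
  have [w0|w0] := leP w 0.
    by constructor 1; rewrite /clamp min_l ?max_l// (le_trans w0).
  have [w1|w1] := leP w 1.
    by constructor 2; rewrite clamp_id// in_itv/= ltW.
  by constructor 3; rewrite /clamp min_r ?max_r ?ltW.
have := ler_norm (u - v); have := ler_norm (v - u); rewrite distrC.
move: `|u - v| (clamp_itv u) (clamp_itv v) (cases u) (cases v) => n.
rewrite !in_itv/= => /andP[cu0 cu1] /andP[cv0 cv1].
by move=> [[? cu]|cu|[? cu]] [[? cv]|cv|[? cv]] ? ?;
  rewrite ler_norml; apply/andP; split; lra.
Qed.

Lemma continuous_of_lipschitz (f : R -> R) (K : R) :
  (forall u v, `|f u - f v| <= K * `|u - v|) -> continuous f.
Proof.
move=> fK u; apply/cvgrPdist_le => e e0.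
have K1 : 0 < `|K| + 1 by rewrite ltr_pwDr.
near=> v.
apply: (le_trans (fK _ _)).
apply: (@le_trans _ _ ((`|K| + 1) * `|u - v|)).
  by rewrite ler_wpM2r// (le_trans (ler_norm _))// lerDl.
rewrite mulrC -ler_pdivlMr//; near: v.
by apply: cvgr_dist_le; rewrite ?divr_gt0//; exact: cvg_id.
Unshelve. all: end_near. Qed.

Lemma continuous_clamp : continuous clamp.
Proof.
apply: (@continuous_of_lipschitz _ 1) => u v.
by rewrite mul1r clamp_dist.
Qed.

Lemma measurable_clamp : measurable_fun setT clamp.
Proof. exact: continuous_measurable_fun continuous_clamp. Qed.

Definition unif : probability (measurableTypeR R) R := uniform_prob (@ltr01 R).

(** The uniform density is 1 on $[0,1]$; positive and negative parts are
    integrated separately. *)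
Lemma integral_unif (f : R -> \bar R) : measurable_fun setT f ->
  (\int[unif]_u f u = \int[lebesgue_measure]_(u in `[0%R, 1%R]) f u)%E.
Proof.
move=> mf; rewrite integralE [RHS]integralE.
rewrite !integral_uniform//; last 2 first.
- exact: measurable_funeneg.
- exact: measurable_funepos.
by rewrite subr0 invr1 !mul1e.
Qed.

(** By the extreme value theorem on $[0,1]$, whose points are exactly the values
    of [clamp]. *)
Lemma continuous_clamp_bounded (f : R -> R) : continuous (f \o clamp) ->
  exists M, forall u, `|f (clamp u)| <= M.
Proof.
move=> cf.
have [c _ fc] := @EVT_max R (fun u => `|f (clamp u)|) 0 1 ler01
  (continuous_subspaceT (fun u => cvg_norm (cf u))).
exists `|f (clamp c)| => u.
by rewrite -(clamp_id (clamp_itv u)) fc// clamp_itv.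
Qed.

End unit_interval.

Section mean_int.
Context {d} {T : measurableType d} {R : realType} (P : probability T R).

(** Fubini: $E \int_0^1$ is one integral over the product space.  The inner
    integral is finite only for almost every sample point, hence the
    almost-everywhere comparison. *)
Lemma mean_int_mxE {m n} (M : R -> T -> 'M[R]_(m, n)) a b :
  (unif \x P)%E.-integrable setT
    (fun x : R * T => (M (clamp x.1) x.2 a b)%:E) ->
  mean_int_mx P M a b = \int[(unif \x P)%E]_x M (clamp x.1) x.2 a b.
Proof.
move=> iM; have mM := measurable_int _ iM.
have GE t : (\int[lebesgue_measure]_(u in `[0%R, 1%R]) (M u t a b)%:E =
    fubini_G unif (fun x : R * T => (M (clamp x.1) x.2 a b)%:E) t)%E.
  rewrite /fubini_G integral_unif; last exact: measurable_fun_pair1 mM.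
  by apply: eq_integral => u /[!inE] u01; rewrite clamp_id.
have mG := measurable_fubini_G iM.
rewrite mxE /Rintegral; congr fine.
rewrite -(integral21_prod_meas1 iM) unlock; apply: ae_eq_integral => //.
- apply/measurable_EFinP; apply: measurableT_comp; first by [].
  by under eq_fun do rewrite GE.
- apply: filterS (ae_integrable2 iM) => t iG _ /=.
  by rewrite GE fineK// integrable_fin_num.
Qed.

End mean_int.

(** * Measurability, stationarity and norms *)

Section generated_sigma_algebras.
Context {d d'} {T : measurableType d} {rT : measurableType d'}.

(** Measurability into a space carrying a coordinate sigma-algebra is checked on
    the coordinates. *)
Lemma measurable_fun_cylinders {I : Type} {aT : pointedType} (f : I -> aT -> rT)
    (g : T -> aT) : (forall a, measurable_fun setT (f a \o g)) ->
  measurable_fun setT (g : T -> g_sigma_algebraType (cylinders f)).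
Proof.
move=> fg; apply: (@measurability _ _ T (g_sigma_algebraType (cylinders f)) setT g (cylinders f)) => //.
move=> _ [_ [a _ [B mB <-]] <-].
rewrite setTI; exact: fg.
Qed.

Lemma measurable_cylinder_proj {I : Type} {aT : pointedType} (f : I -> aT -> rT) a :
  measurable_fun setT (f a : g_sigma_algebraType (cylinders f) -> rT).
Proof. by move=> _ B mB; apply: sub_sigma_algebra; exists a => //; exists B. Qed.

End generated_sigma_algebras.

Lemma measurable_fun_coord {d} {T : measurableType d} {R : realType} {m}
    (D : set T) (U : T -> 'cV[R]_m) c :
  measurable_fun D (U : T -> vec_space R m) -> measurable_fun D (fun t => U t c 0).
Proof.
move=> mU.
have mc := @measurable_cylinder_proj _ _ _ _ (fun (c : 'I_m) (v : 'cV[R]_m) => v c 0 : R) c.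
exact: (measurableT_comp mc mU).
Qed.

Section stationarity.
Context {dT dE} {T : measurableType dT} {E : measurableType dE} {R : realType}.
Variables (P : probability T R) (xi : int -> T -> E).

(** A pi-system generating the product sigma-algebra; the law of the past is
    explicit on it by independence. *)
Definition finite_cylinder : set (set (nat -> E)) :=
  [set A | exists n (B : nat -> set E), (forall j, measurable (B j)) /\
     A = [set w | forall j, (j < n)%N -> B j (w j)]].

Lemma finite_cylinderI : setI_closed finite_cylinder.
Proof.
move=> _ _ [n [B [mB ->]]] [m [C [mC ->]]].
exists (maxn n m), (fun j => (if (j < n)%N then B j else setT) `&`
                           (if (j < m)%N then C j else setT)).
split=> [j|]; first by apply: measurableI; case: ifP.
apply/seteqP; split=> w /=.
  move=> [wB wC] j _; split; case: ifP => // jn; [exact: wB|exact: wC].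
by move=> wBC; split=> j jn; have := wBC j; rewrite leq_max jn ?orbT => /(_ isT) [].
Qed.

Lemma finite_cylinder_generates :
  @measurable _ (seq_space E) = <<s finite_cylinder >>.
Proof.
apply/seteqP; split; apply: smallest_sub; try exact: smallest_sigma_algebra.
  move=> _ [j _ [B mB <-]]; apply: sub_sigma_algebra.
  exists j.+1, (fun k => if k == j then B else setT); split=> [k|].
    by case: ifP.
  apply/seteqP; split=> w /=.
    by move=> [_ wB] k _; have [->|_] := eqVneq k j; [exact: wB|exact: I].
  by move/(_ j (ltnSn j)); rewrite eqxx; split.
move=> _ [n [B [mB ->]]].
rewrite (_ : [set w | _] = \bigcap_(j in [set k | (k < n)%N])
    ((fun w : nat -> E => w j) @^-1` B j)); last first.
  by apply/seteqP; split=> w /= wB j; exact: wB.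
apply: (@fin_bigcap_measurable _ (seq_space E)) => [|j _]; first exact: finite_II.
by apply: sub_sigma_algebra; exists j => //; exists (B j) => //; rewrite setTI.
Qed.

Hypothesis xi_measurable : forall k, measurable_fun setT (xi k).

Lemma measurable_past k : measurable_fun setT (past xi k : T -> seq_space E).
Proof. by apply: measurable_fun_cylinders => j; exact: xi_measurable. Qed.

Hypothesis xi_iid : iid P xi.

(** By independence the probability factors over the coordinates, and each
    factor is the same at all times; so the value does not involve [k]. *)
Lemma past_finite_cylinder k n (B : nat -> set E) :
  (forall j, measurable (B j)) ->
  P (past xi k @^-1` [set w | forall j, (j < n)%N -> B j (w j)]) =
  (\prod_(j <- iota 0 n) P (xi 0 @^-1` B j))%E.
Proof.
move=> mB; have [_ same indep] := xi_iid.
pose s := [seq k - j%:Z | j <- iota 0 n].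
(* The constraint on the coordinate [j] of the past at time [k] is one on the
   noise at time [k - j]; [C] indexes it by that time. *)
pose C (m : int) := B `|k - m|%N.
have CB j : C (k - j%:Z) = B j by rewrite /C opprB addrC subrK absz_nat.
have us : uniq s by rewrite map_inj_uniq ?iota_uniq// => a b /addrI/oppr_inj [].
transitivity (P (\bigcap_(i in [set` s]) xi i @^-1` C i)).
  congr (P _); apply/seteqP; split=> t /= tB.
    move=> _ /= /mapP[j + ->]; rewrite mem_iota add0n => jn.
    rewrite CB; exact: tB.
  move=> j jn; rewrite -CB; apply: tB => /=.
  by apply/mapP; exists j; rewrite // mem_iota.
have mC m : measurable (C m) by exact: mB.
apply: (eq_trans (indep s C us mC)).
rewrite big_map; apply: eq_bigr => j _; rewrite CB; exact: same.
Qed.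

(** The laws of the past at two times agree on a generating pi-system, hence
    everywhere. *)
Lemma integral_past_stationary k l (f : (nat -> E) -> \bar R) :
  measurable_fun setT (f : seq_space E -> \bar R) -> (forall w, (0 <= f w)%E) ->
  (\int[P]_t f (past xi k t) = \int[P]_t f (past xi l t))%E.
Proof.
move=> mf f0.
pose X m : {mfun T >-> seq_space E} := HB.pack (past xi m : T -> seq_space E)
  (isMeasurableFun.Build _ _ _ _ (past xi m : T -> seq_space E) (measurable_past m)).
rewrite -[LHS](ge0_integral_distribution (X k) mf f0).
rewrite -[RHS](ge0_integral_distribution (X l) mf f0).
apply: eq_measure_integral => A mA _.
apply: (@measure_unique _ R (seq_space E) finite_cylinder (fun=> setT) _ _ _ _ (distribution P (X k)) (distribution P (X l))) => //.
- exact: finite_cylinder_generates.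
- exact: finite_cylinderI.
- by exists 0%N, (fun=> setT); split=> //; apply/seteqP.
- by rewrite bigcup_const//; exists 0%N.
- move=> _ [n [B [mB ->]]].
  exact: (eq_trans (past_finite_cylinder k n mB)
    (esym (past_finite_cylinder l n mB))).
- by move=> _; rewrite /= probability_setT ltry.
Qed.

End stationarity.

Section Lr_norms.
Context {d} {T : measurableType d} {R : realType} (P : probability T R) {m : nat}.
Implicit Types (U W : T -> 'cV[R]_m) (v w : 'cV[R]_m).

Definition sqnorm (v : 'cV[R]_m) : R := \sum_c v c 0 ^+ 2.

Lemma sqnorm_ge0 v : 0 <= sqnorm v.
Proof. by apply: sumr_ge0 => c _; exact: sqr_ge0. Qed.

Lemma sqr_coord_le v c : v c 0 ^+ 2 <= sqnorm v.
Proof.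
by rewrite /sqnorm (bigD1 c)//= lerDl; apply: sumr_ge0 => k _; exact: sqr_ge0.
Qed.

Lemma sqr_enorm v : enorm v ^+ 2 = sqnorm v.
Proof. by rewrite sqr_sqrtr// sqnorm_ge0. Qed.

Lemma measurable_sqnorm U : (forall c, measurable_fun setT (fun t => U t c 0)) ->
  measurable_fun setT (fun t => sqnorm (U t)).
Proof. by move=> mU; apply: measurable_sum => c; exact: measurable_funX. Qed.

(** From $w = v - (v - w)$ and $|a - b|^2 \le 2 |a|^2 + 2 |b|^2$. It plays the
    role of the triangle inequality in $L^2$. *)
Lemma sqnorm_sub_le v w :
  sqnorm w <= 2 * sqnorm v + 2 * sqnorm (v - w).
Proof.
rewrite /sqnorm !mulr_sumr -big_split/=; apply: ler_sum => c _.
(* $2 a^2 + 2 (a - b)^2 - b^2 = (2 a - b)^2$. *)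
rewrite !mxE; have := sqr_ge0 (2 * v c 0 - w c 0).
by move: (v c 0) (w c 0) => a b; nra.
Qed.

Lemma integral_sqnorm_sub_le U W :
  (forall c, measurable_fun setT (fun t => U t c 0)) ->
  (forall c, measurable_fun setT (fun t => W t c 0)) ->
  (\int[P]_t (sqnorm (W t))%:E <= 2%:E * \int[P]_t (sqnorm (U t))%:E +
     2%:E * \int[P]_t (sqnorm (U t - W t))%:E)%E.
Proof.
move=> mU mW.
have mS := measurable_sqnorm mU; have mS' := measurable_sqnorm mW.
have mD : measurable_fun setT (fun t => sqnorm (U t - W t)).
  apply: measurable_sqnorm => c; rewrite (_ : (fun t => _) = fun t => U t c 0 - W t c 0).
    exact: measurable_funB.
  by apply/funext => t; rewrite !mxE.
rewrite -!ge0_integralZl//; try exact/measurable_EFinP;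
  try by move=> t _; rewrite lee_fin sqnorm_ge0.
rewrite -ge0_integralD//; try by [move=> t _; rewrite -EFinM lee_fin mulr_ge0 ?sqnorm_ge0
  | apply/measurable_EFinP; exact: measurable_funM].
apply: ge0_le_integral => //.
- by move=> t _; rewrite lee_fin sqnorm_ge0.
- exact/measurable_EFinP.
- by apply/measurable_EFinP; apply: measurable_funD; exact: measurable_funM.
- by move=> t _; rewrite -!EFinM -EFinD lee_fin sqnorm_sub_le.
Qed.

Lemma Lr_norm2_le (K : R) U : 0 <= K -> (Lr_norm P 2%R U <= K%:E)%E ->
  (\int[P]_t (sqnorm (U t))%:E <= (K ^+ 2)%:E)%E.
Proof.
move=> K0 UK.
have : (Lr_norm P 2%R U `^ 2 <= K%:E `^ 2)%E.
  by apply: gt0_ler_poweR => //; rewrite in_itv/= ?Lnorm_ge0 ?lee_fin ?K0 leey.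
rewrite /Lr_norm powR_Lnorm// poweR_EFin powR_mulrn//; apply: le_trans.
rewrite le_eqVlt; apply/orP; left; apply/eqP; apply: eq_integral => t _.
by rewrite /= -sqr_enorm ger0_norm ?sqrtr_ge0// powR_mulrn ?sqrtr_ge0.
Qed.

(** On a probability space a finite moment of order at least 2 dominates the
    second one, since $x^2 \le 1 + x^r$ for $x \ge 0$. *)
Lemma Lr_norm_lty (r : R) U : (forall c, measurable_fun setT (fun t => U t c 0)) ->
  2 <= r -> (Lr_norm P r U < +oo)%E -> (\int[P]_t (sqnorm (U t))%:E < +oo)%E.
Proof.
move=> mU r2 Uoo.
have r0 : 0 < r by rewrite (lt_le_trans _ r2).
have mS := measurable_sqnorm mU.
have mp : measurable_fun setT (fun t => enorm (U t) `^ r).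
  rewrite (_ : (fun t => _) = fun t => sqnorm (U t) `^ (r / 2)).
    exact: (measurableT_comp (measurable_powR _) mS).
  apply/funext => t; rewrite -sqr_enorm -powR_mulrn ?sqrtr_ge0// -powRrM.
  by rewrite mulrCA divff// mulr1.
have := poweR_lty r Uoo.
rewrite /Lr_norm powR_Lnorm ?gt_eqF// => ioo.
apply: (@le_lt_trans _ _ (\int[P]_t (1 + (enorm (U t) `^ r)%:E)%E)%E).
  apply: ge0_le_integral => //.
  - by move=> t _; rewrite lee_fin sqnorm_ge0.
  - exact/measurable_EFinP.
  - by apply/measurable_EFinP; exact: measurable_funD.
  - move=> t _; rewrite lee_fin -sqr_enorm.
    have e0 : 0 <= enorm (U t) by exact: sqrtr_ge0.
    have [e1|e1] := leP (enorm (U t)) 1.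
      by rewrite (@le_trans _ _ 1)// ?exprn_ile1// lerDl powR_ge0.
    rewrite -powR_mulrn// (@le_trans _ _ (enorm (U t) `^ r))//; last by rewrite lerDr.
    by rewrite ler_powR// ltW.
rewrite ge0_integralD//; last 2 first.
- by move=> t _; rewrite lee_fin powR_ge0.
- exact/measurable_EFinP.
apply: lte_add_pinfty.
  by rewrite integral_cst// mul1e [X in (X < _)%E](probability_setT P) ltry.
move: ioo; apply: le_lt_trans.
rewrite le_eqVlt; apply/orP; left; apply/eqP; apply: eq_integral => t _.
by rewrite /= ger0_norm ?sqrtr_ge0.
Qed.

End Lr_norms.

(** * Uniform moment bounds for the stationary approximations *)

Section array_bounds.
Context {dT dE} {T : measurableType dT} {E : measurableType dE} {R : realType}.
Variables (P : probability T R) (xi : int -> T -> E) (m : nat).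
Hypothesis xi_measurable : forall k, measurable_fun setT (xi k).
Hypothesis xi_iid : iid P xi.

Lemma array_sup_ub (f : nat -> nat -> \bar R) n j :
  (1 <= j <= n)%N -> (f n j <= array_sup f)%E.
Proof. by move=> jn; apply: ereal_sup_ubound; exists (n, j). Qed.

Variables (J : nat -> nat -> (nat -> E) -> 'cV[R]_m) (Z : R -> (nat -> E) -> 'cV[R]_m).
Hypothesis J_measurable : forall n j, (1 <= j <= n)%N ->
  measurable_fun setT (J n j : seq_space E -> vec_space R m).
Hypothesis Z_measurable : forall u, u \in `[0, 1] ->
  measurable_fun setT (Z u : seq_space E -> vec_space R m).

(** One finite second moment suffices, because the Lipschitz condition compares
    all $u \in [0,1]$ with it and stationarity compares all times.  It is found
    at $u = 1/n$ and time 1, where the approximation is within $C/n$ of the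
    array, itself bounded by its moment of order [r] at time 0. *)
Lemma stationary_L2_bound (r : R) (k : int) : 2 <= r ->
  (array_Lr_sup P xi J r < +oo)%E ->
  (exists C : R, \forall n \near \oo, forall j, (1 <= j <= n)%N ->
     (Lr_norm P 2%R (fun t => J n j (past xi j t) - Z (j%:R / n%:R) (past xi j t))%R
       <= (C / n%:R)%:E)%E) ->
  (exists2 C : R, 0 < C & forall (j : int) (u v : R), u \in `[0, 1] -> v \in `[0, 1] ->
     (Lr_norm P 2%R (fun t => Z u (past xi j t) - Z v (past xi j t))%R
       <= (C * `|u - v|)%:E)%E) ->
  exists K : R, forall u, u \in `[0, 1] ->
    (\int[P]_t (sqnorm (Z u (past xi k t)))%:E <= K%:E)%E.
Proof.
move=> r2 Joo [C [n0 _ approxC]] [L L0 lipL].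
pose n := n0.+1; have n1 : (1 <= 1 <= n)%N by [].
have := approxC n (leqnSn n0) 1%N n1; set u0 := 1%:R / _ => ap.
have u01 : u0 \in `[0, 1].
  by rewrite in_itv/= /u0 divr_ge0//= ler_pdivrMr ?ltr0n// mul1r ler1n.
have coord (f : (nat -> E) -> 'cV[R]_m) l :
    measurable_fun setT (f : seq_space E -> vec_space R m) ->
    forall c, measurable_fun setT (fun t => f (past xi l t) c 0).
  move=> mf c; apply: measurable_fun_coord.
  exact: (measurableT_comp mf (measurable_past xi_measurable l)).
have sq_meas (f : (nat -> E) -> 'cV[R]_m) :
    measurable_fun setT (f : seq_space E -> vec_space R m) ->
    measurable_fun setT ((fun w => (sqnorm (f w))%:E) : seq_space E -> \bar R).
  move=> mf; apply/measurable_EFinP; apply: measurable_sum => c.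
  by apply: measurable_funX; apply: measurable_fun_coord.
have stat l l' (f : (nat -> E) -> 'cV[R]_m) :
    measurable_fun setT (f : seq_space E -> vec_space R m) ->
    (\int[P]_t (sqnorm (f (past xi l t)))%:E = \int[P]_t (sqnorm (f (past xi l' t)))%:E)%E.
  move=> mf; apply: (integral_past_stationary xi_measurable xi_iid l l' (sq_meas f mf)).
  by move=> w; rewrite lee_fin sqnorm_ge0.
have JL2 : (\int[P]_t (sqnorm (J n 1 (past xi 1 t)))%:E < +oo)%E.
  rewrite (stat _ 0 (J n 1) (J_measurable n1)).
  apply: (Lr_norm_lty _ r2); first exact: (coord _ 0 (J_measurable n1)).
  exact: le_lt_trans (array_sup_ub _ n1) Joo.
have C0 : 0 <= C / n%:R by rewrite -lee_fin (le_trans _ ap)// Lnorm_ge0.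
have DL2 := Lr_norm2_le C0 ap.
have Z0 : (\int[P]_t (sqnorm (Z u0 (past xi 1 t)))%:E < +oo)%E.
  apply: (le_lt_trans (integral_sqnorm_sub_le P
    (coord _ 1 (J_measurable n1)) (coord _ 1 (Z_measurable u01)))).
  rewrite lte_add_pinfty// lte_mul_pinfty//; first exact: le_lt_trans DL2 (ltry _).
have Z0_ge0 : (0 <= \int[P]_t (sqnorm (Z u0 (past xi 1 t)))%:E)%E.
  by apply: integral_ge0 => t _; rewrite lee_fin sqnorm_ge0.
exists (2 * fine (\int[P]_t (sqnorm (Z u0 (past xi 1 t)))%:E)%E + 2 * L ^+ 2) => u u1.
rewrite (stat _ 1 (Z u) (Z_measurable u1)).
apply: (le_trans (integral_sqnorm_sub_le P
    (coord _ 1 (Z_measurable u01)) (coord _ 1 (Z_measurable u1)))).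
rewrite [leRHS]EFinD ![in leRHS]EFinM fineK; last by rewrite ge0_fin_numE.
rewrite leeD2l// lee_pmul2l//.
apply: le_trans (Lr_norm2_le _ (lipL 1 u0 u u01 u1)) _.
  by rewrite mulr_ge0 ?(ltW L0).
rewrite lee_fin lerXn2r// ?nnegrE ?mulr_ge0 ?(ltW L0)// ler_piMr ?(ltW L0)//.
move: u01 u1; rewrite !in_itv/= => /andP[? ?] /andP[? ?].
by rewrite ler_norml; apply/andP; split; lra.
Qed.

End array_bounds.

(** * Conditional variance *)

Section transfer_of_integrals.
Context {d d'} {T : measurableType d} {V : measurableType d'} {R : realType}.
Variables (mu : {measure set T -> \bar R}) (x : T -> V).
Hypothesis mx : measurable_fun setT x.
Import HBNNSimple.
Local Open Scope ereal_scope.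

Let integral_nnsfun_mul (f : {nnsfun V >-> R}) (g : T -> \bar R) :
  measurable_fun setT g -> (forall t, 0 <= g t) ->
  \int[mu]_t ((f (x t))%:E * g t) =
  \sum_(r \in range f) r%:E * \int[mu]_(t in x @^-1` (f @^-1` [set r])) g t.
Proof.
move=> mg g0.
have mr r : measurable (x @^-1` (f @^-1` [set r])).
  by rewrite -[X in measurable X]setTI; apply: mx.
have mi r : measurable_fun setT (fun t => \1_(f @^-1` [set r]) (x t) : R).
  exact: (measurableT_comp _ mx).
under eq_integral => t _.
  rewrite fimfunE -fsumEFin// ge0_mule_fsuml => [|y]; last first.
    exact: nnfun_muleindic_ge0.
  over.
rewrite ge0_integral_fsum//; last 2 first.
  - move=> y; apply: emeasurable_funM => //; apply/measurable_EFinP.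
    exact: measurable_funM.
  - by move=> m y Ey; rewrite mule_ge0// nnfun_muleindic_ge0.
apply: eq_fsbigr => r; rewrite inE => -[v _ fvr].
under eq_integral do rewrite EFinM -muleA.
rewrite ge0_integralZl//.
- congr (_ * _); rewrite [RHS]integral_mkcond; apply: eq_integral => t _.
  rewrite epatch_indic muleC; congr (_ * _).
- by apply: emeasurable_funM => //; apply/measurable_EFinP.
- by move=> t _; rewrite mule_ge0// lee_fin.
- by rewrite lee_fin -fvr.
Qed.

(** If $g_1$ and $g_2$ have the same integrals over the events described by [x],
    they have the same integrals against all nonnegative functions of [x]:
    approximate these by simple functions. *)
Lemma ge0_integral_mul_transfer (h : V -> R) (g1 g2 : T -> R) :
  measurable_fun setT h -> (forall v, (0 <= h v)%R) ->
  measurable_fun setT g1 -> (forall t, (0 <= g1 t)%R) ->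
  measurable_fun setT g2 -> (forall t, (0 <= g2 t)%R) ->
  (forall B, measurable B ->
     \int[mu]_(t in x @^-1` B) (g1 t)%:E = \int[mu]_(t in x @^-1` B) (g2 t)%:E) ->
  \int[mu]_t (h (x t) * g1 t)%:E = \int[mu]_t (h (x t) * g2 t)%:E.
Proof.
move=> mh h0 mg1 g10 mg2 g20 g12.
have mhE : measurable_fun setT (EFin \o h) by exact/measurable_EFinP.
pose f_ := nnsfun_approx measurableT mhE.
have approx (g : T -> R) : measurable_fun setT g -> (forall t, (0 <= g t)%R) ->
    \int[mu]_t (h (x t) * g t)%:E =
    limn (fun n => \int[mu]_t ((f_ n (x t))%:E * (g t)%:E)).
  move=> mg g0; rewrite -monotone_convergence//.
  - apply: eq_integral => t _; rewrite EFinM; apply/esym/cvg_lim => //.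
    apply: cvgeZr => //; apply: (cvg_nnsfun_approx measurableT mhE) => //.
    by move=> v _; rewrite lee_fin.
  - move=> n; apply: emeasurable_funM; apply/measurable_EFinP => //.
    exact: (measurableT_comp _ mx).
  - by move=> n t _; rewrite mule_ge0 ?lee_fin.
  - move=> t _ a b ab; rewrite lee_wpmul2r ?lee_fin//.
    exact/lefP/nd_nnsfun_approx.
rewrite !approx//; congr (limn _); apply/funext => n.
rewrite !integral_nnsfun_mul//; try exact/measurable_EFinP.
by apply: eq_fsbigr => r _; rewrite g12// -[X in measurable X]setTI.
Qed.

End transfer_of_integrals.

Section conditional_variance.
Context {d} {T : measurableType d} {R : realType} (P : probability T R).
Variable F : set (set T).
Hypothesis mF : F `<=` measurable.

Lemma measurable_wrt_fun {d'} {V : measurableType d'} (f : T -> V) :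
  measurable_wrt F f -> measurable_fun setT f.
Proof. by move=> Ff _ B mB; rewrite setTI; exact/mF/Ff. Qed.

(** The events $\{M \ge 0\}$ and $\{M \le 0\}$ belong to $F$, and [M] has
    zero integral and constant sign on each. *)
Lemma cond_exp_null (M : T -> R) : P.-integrable setT (EFin \o M) ->
  measurable_wrt F M ->
  (forall A, F A -> (\int[P]_(t in A) (M t)%:E = 0)%E) ->
  {ae P, forall t, M t = 0}.
Proof.
move=> iM FM M0; have mM := measurable_wrt_fun FM.
have mME : measurable_fun setT (EFin \o M) by exact/measurable_EFinP.
have aux (B : set R) : measurable B ->
    ((forall r, B r -> 0 <= r) \/ (forall r, B r -> r <= 0)) ->
    {ae P, forall t, B (M t) -> M t = 0}.
  move=> mB B0.
  have mA : measurable (M @^-1` B) by exact/mF/FM.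
  have abs0 : (\int[P]_(t in M @^-1` B) `|(M t)%:E| = 0)%E.
    case: B0 => B0.
      rewrite -[RHS](M0 _ (FM _ mB)); apply: eq_integral => t /[!inE] Bt.
      by rewrite gee0_abs// lee_fin B0.
    rewrite (eq_integral (fun t => (-1)%:E * (M t)%:E)%E); last first.
      by move=> t /[!inE] Bt; rewrite mulN1e lee0_abs// lee_fin B0.
    rewrite integralZl//; first by rewrite (M0 _ (FM _ mB)) mule0.
    exact: (integrableS measurableT).
  have := (ae_eq_integral_abs P mA (measurable_funTS mME)).1 abs0.
  by apply: filterS => t /= + Bt => /(_ Bt) [].
have pos := aux `[0, +oo[%classic (measurable_itv _) (or_introl _).
have neg := aux `]-oo, 0]%classic (measurable_itv _) (or_intror _).
apply: filterS2 (pos _) (neg _).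
- move=> t /=; rewrite !in_itv/= andbT => Mp Mn.
  by have [/Mp|/ltW/Mn] := leP 0 (M t).
- by move=> r /=; rewrite in_itv/= andbT.
- by move=> r /=; rewrite in_itv/=.
Qed.

(** The conditional mean in the definition of conditional variance is only
    some version of it; it vanishes almost surely because 0 is another
    version, so the centred square is the plain square. *)
Lemma cond_var_mds (e s2 : T -> R) :
  is_cond_exp P F e (cst 0) -> is_cond_var P F e s2 ->
  forall A, F A -> (\int[P]_(t in A) (e t ^+ 2)%:E = \int[P]_(t in A) (s2 t)%:E)%E.
Proof.
move=> [ie _ _ e0] [M [_ iM FM eM] [_ _ Fs eMs]] A FA.
have M0 : {ae P, forall t, M t = 0}.
  apply: cond_exp_null => // B FB; rewrite -eM// e0//.
  by rewrite integral0.
rewrite -eMs//; apply: ae_eq_integral.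
- exact: mF.
- apply/measurable_EFinP/measurable_funX/measurable_funTS.
  by apply/measurable_EFinP; exact: (measurable_int _ ie).
- apply/measurable_EFinP/measurable_funX/measurable_funTS/measurable_funB.
    by apply/measurable_EFinP; exact: (measurable_int _ ie).
  exact: measurable_wrt_fun.
- by apply: filterS M0 => t /= -> _; rewrite subr0.
Qed.

End conditional_variance.

(** * Continuity in time of the second moments *)

Section continuous_matrices.
Context {R : realType}.

Lemma continuous_det n (M : R -> 'M[R]_n) :
  (forall a b, continuous (fun u => M u a b)) -> continuous (fun u => \det (M u)).
Proof.
move=> cM; apply: continuous_big => [|s _]; first exact: add_continuous.
move=> u; apply: cvgM; first exact: cvg_cst.
by apply: (cvg_big (@mul_continuous R)) => a _; exact: cM.
Qed.

(** By Cramer's rule. *)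
Lemma continuous_invmx n (M : R -> 'M[R]_n) :
  (forall u, M u \in unitmx) -> (forall a b, continuous (fun u => M u a b)) ->
  forall a b, continuous (fun u => invmx (M u) a b).
Proof.
move=> uM cM a b.
rewrite (_ : (fun u => _) = fun u => (\det (M u))^-1 *
    ((-1) ^+ (b + a) * \det (row' b (col' a (M u))))); last first.
  by apply/funext => u; rewrite /invmx uM !mxE.
move=> u; apply: cvgM.
  by apply: cvgV; [rewrite -unitfE -unitmxE|exact: continuous_det].
apply: cvgM; first exact: cvg_cst.
apply: continuous_det => c d.
by under eq_fun do rewrite !mxE; exact: cM.
Qed.

Lemma continuous_mulmx m n l (M : R -> 'M[R]_(m, n)) (N : R -> 'M[R]_(n, l)) :
  (forall a b, continuous (fun u => M u a b)) ->
  (forall a b, continuous (fun u => N u a b)) ->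
  forall a b, continuous (fun u => (M u *m N u) a b).
Proof.
move=> cM cN a b; under eq_fun do rewrite mxE.
apply: continuous_big => [|k _ u]; first exact: add_continuous.
by apply: cvgM; [exact: cM|exact: cN].
Qed.

End continuous_matrices.

Section fields.
Context {d} {T : measurableType d} {R : realType} {P : probability T R}.

Lemma sqint_finite (f : T -> R) : measurable_fun setT f ->
  (\int[P]_t (f t ^+ 2)%:E < +oo)%E -> sqint P f.
Proof.
move=> mf foo; split => //; apply/integrableP; split.
  by apply/measurable_EFinP; exact: measurable_funX.
by under eq_integral do rewrite /= ger0_norm ?sqr_ge0//.
Qed.

(** A second moment bounded uniformly in time is integrable in time (Tonelli). *)
Lemma sqint_field (Z : R * T -> R) (K : R) : measurable_fun setT Z ->
  (forall u, (\int[P]_t (Z (u, t) ^+ 2)%:E <= K%:E)%E) ->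
  sqint (unif \x P)%E Z /\ forall u, sqint P (fun t => Z (u, t)).
Proof.
move=> mZ ZK; split; last first.
  move=> u; apply: sqint_finite; first exact: measurable_fun_pair2 mZ.
  exact: le_lt_trans (ZK u) (ltry _).
split=> //; have mZ2 : measurable_fun setT (fun x => (Z x ^+ 2)%:E).
  by apply/measurable_EFinP; exact: measurable_funX.
apply: (@integrable12ltyP _ _ _ _ _ unif P _ mZ2).2.
apply: (@le_lt_trans _ _ (\int[unif]_(u in [set: R]) K%:E)%E).
  apply: ge0_le_integral => //.
  - by move=> u _; exact: integral_ge0.
  - apply: (measurable_fun_fubini_tonelli_F (fun x => `|(Z x ^+ 2)%:E|%E)) => //.
    exact: measurableT_comp.
  - move=> u _; apply: le_trans (ZK u).
    by under eq_integral do rewrite gee0_abs ?lee_fin ?sqr_ge0//.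
rewrite integral_cst//= [X in (_ * X)%E](probability_setT unif) mule1.
exact: ltry.
Qed.

(** Cauchy-Schwarz replaced by the weighted inequality
    $|f g| \le D f^2 + D^{-1} g^2$, which directly yields a bound linear in
    [D]; if $D = 0$ then $g$ vanishes almost everywhere. *)
Lemma Rintegral_mul_le (f g : T -> R) (K C D : R) : sqint P f -> sqint P g ->
  0 <= D ->
  (\int[P]_t (f t ^+ 2)%:E <= K%:E)%E ->
  (\int[P]_t (g t ^+ 2)%:E <= ((C * D) ^+ 2)%:E)%E ->
  `| \int[P]_t (f t * g t) | <= (K + C ^+ 2) * D.
Proof.
move=> sf sg; rewrite le_eqVlt => /predU1P[<- _|D0 fK gC].
  rewrite mulr0 expr0n/= => g0.
  have : \int[P]_t (g t * g t) = 0.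
    rewrite /Rintegral (_ : (\int[P]_t _ = 0)%E)//; apply/eqP; rewrite eq_le.
    rewrite integral_ge0 ?andbT; last by move=> t _; rewrite lee_fin -expr2 sqr_ge0.
    by under eq_integral do rewrite -expr2.
  move/(sqint_eq0 sg) => ae0.
  rewrite /Rintegral (ae_eq_integral (cst 0%E))//.
  - by rewrite integral0 normr0 mulr0.
  - by apply/measurable_EFinP; apply: measurable_funM; [case: sf|case: sg].
  - by apply: filterS ae0 => x /= -> _; rewrite mulr0.
have [[mf if2] [mg ig2]] := (sf, sg).
have ifg := integrable_mul_sqint sf sg.
have RK : \int[P]_t (f t ^+ 2) <= K.
  by rewrite -lee_fin /Rintegral fineK ?integrable_fin_num.
have RC : \int[P]_t (g t ^+ 2) <= (C * D) ^+ 2.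
  by rewrite -lee_fin /Rintegral fineK ?integrable_fin_num.
have iD (k : R) (h : T -> R) : P.-integrable setT (EFin \o h) ->
    P.-integrable setT (EFin \o (fun t => k * h t)).
  move=> ih; rewrite (_ : _ \o _ = fun t => (k%:E * (h t)%:E)%E)//.
  exact: integrableZl.
have main : \int[P]_t (D * f t ^+ 2 + D^-1 * g t ^+ 2) <= (K + C ^+ 2) * D.
  rewrite RintegralD ?iD// !RintegralZl//.
  rewrite mulrDl lerD//; first by rewrite mulrC ler_wpM2r// ltW.
  rewrite mulrC ler_pdivrMr// (le_trans RC)//.
  by rewrite le_eqVlt; apply/orP; left; apply/eqP; ring.
have iDD : P.-integrable setT (EFin \o (fun t => D * f t ^+ 2 + D^-1 * g t ^+ 2)).
  exact: (@integrableD _ _ _ P setT measurableT _ _ (iD D _ if2) (iD D^-1 _ ig2)).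
have amgm (x y : R) : `|x * y| <= D * x ^+ 2 + D^-1 * y ^+ 2.
  have Dy : y = D * (D^-1 * y) by rewrite mulrA divff ?gt_eqF// mul1r.
  have -> : D^-1 * y ^+ 2 = D * (D^-1 * y) ^+ 2.
    by rewrite {1}Dy; field; rewrite gt_eqF.
  rewrite [in leLHS]Dy; move: (D^-1 * y) => z.
  rewrite mulrCA normrM (gtr0_norm D0) -mulrDr ler_pM2l//.
  rewrite ler_norml; have := sqr_ge0 (x - z); have := sqr_ge0 (x + z).
  by move=> ? ?; apply/andP; split; nra.
apply: le_trans main.
apply: le_trans (le_normr_Rintegral measurableT ifg) _.
apply: le_Rintegral => //.
by rewrite (_ : _ \o _ = (fun t => `|(f t * g t)%:E|)%E)//; exact: integrable_abse.
Qed.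

Variable m : nat.
Variable X : 'I_m -> R * T -> R.
Variables K C : R.
Hypothesis mX : forall a, measurable_fun setT (X a).
Hypothesis XK : forall a u, (\int[P]_t (X a (u, t) ^+ 2)%:E <= K%:E)%E.
Hypothesis XC : forall a u v,
  (\int[P]_t ((X a (u, t) - X a (v, t)) ^+ 2)%:E <= ((C * `|u - v|) ^+ 2)%:E)%E.

Definition gram_at u : 'M[R]_m :=
  gram P (fun a t => X a (u, t)) (fun a t => X a (u, t)).

(** $f_u g_u - f_v g_v = f_u (g_u - g_v) + g_v (f_u - f_v)$, so that
    $L^2$-Lipschitz, $L^2$-bounded factors have Lipschitz products in mean. *)
Lemma continuous_gram a b : continuous (fun u => gram_at u a b).
Proof.
have sX a' u : sqint P (fun t => X a' (u, t)) := (sqint_field (mX a') (XK a')).2 u.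
apply: (@continuous_of_lipschitz _ _ (2 * (K + C ^+ 2))) => u v.
have sD c := sqintB (sX c u) (sX c v).
have -> : gram_at u a b - gram_at v a b =
   \int[P]_t (X a (u, t) * (X b (u, t) - X b (v, t))) +
   \int[P]_t (X b (v, t) * (X a (u, t) - X a (v, t))).
  rewrite !mxE -RintegralB//; [|exact: integrable_mul_sqint..].
  rewrite -RintegralD//; [|exact: integrable_mul_sqint..].
  by apply: eq_Rintegral => t _; ring.
rewrite -mulrA mulr_natl mulr2n (le_trans (ler_normD _ _))// lerD//.
- exact: (@Rintegral_mul_le _ _ K C `|u - v| (sX a u) (sD b)).
- exact: (@Rintegral_mul_le _ _ K C `|u - v| (sX b v) (sD a)).
Qed.

End fields.

(** * The weighted regression model *)

Section stationary_fields.
Context {R : realType} {dT dE : measure_display}.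
Context {T : measurableType dT} {E : measurableType dE}.
Context (P : probability T R) {p1 p2 : nat} (S : regression R T E p1 p2).
Hypothesis model : regression_model P S.
Local Notation d0 := (p1 + p2)%N.
Local Notation xi := (noise S).
Local Notation bounded_coef := (@bounded_coef _ (measurableTypeR R) R p1 p2).

Lemma noise_measurable k : measurable_fun setT (xi k).
Proof. exact: (iid_measurable (noise_iid model) (inl k)). Qed.

Lemma noise_is_iid : iid P xi.
Proof.
have [mN sN iN] := noise_iid model; split.
- by move=> k; exact: (mN (inl k)).
- by move=> k l B mB; exact: (sN (inl k) (inl l)).
- move=> s B us mB.
  (* The independent copies are left unconstrained. *)
  pose C (k : int + int) := match k with inl k => B k | inr _ => setT end.
  have us' : uniq [seq inl k : int + int | k <- s].
    by rewrite map_inj_uniq// => ? ? [].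
  have mC k : measurable (C k) by case: k => k; [exact: mB|exact: measurableT].
  apply: (eq_trans _ (eq_trans (iN _ C us' mC) _)); last by rewrite big_map.
  congr (P _); apply/seteqP; split=> t /= tB.
    by move=> _ /= /mapP[k ks ->]; exact: tB.
  by move=> k ks; apply: (tB (inl k)) => /=; apply: map_f.
Qed.

Lemma past_sigma_measurable k : past_sigma xi k `<=` measurable.
Proof.
move=> _ [B mB <-].
exact: (measurable_past noise_measurable).
Qed.

Lemma measurable_slice {d d'} {V : measurableType d} {W : measurableType d'}
    (phi : R * V -> W) (u : R) : u \in `[0, 1] ->
  measurable_fun (`[0, 1]%classic `*` setT : set (R * V)) phi ->
  measurable_fun setT (fun v => phi (u, v)).
Proof.
move=> u01 mphi; apply: (@measurable_comp _ _ _ _ _ _ _ _ _ (fun v => (u, v)) _ _ mphi) => //.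
- exact: measurableX.
- by move=> _ /= [v _ <-].
- exact: pair1_measurable.
Qed.

Lemma measurable_x_stat i : measurable_fun setT
  ((fun x => x_stat S (clamp x.1) i x.2) : R * T -> vec_space R d0).
Proof.
apply: (@measurable_comp _ _ _ _ _ _ _ _ _
  (fun x : R * T => (clamp x.1, past xi i x.2 : seq_space E)) _ _
  (x_stat_fun_measurable model)).
- exact: measurableX.
- by move=> _ /= [x _ <-] /=; split => //; have := clamp_itv x.1.
- apply: measurable_fun_pair; first exact: (measurableT_comp measurable_clamp).
  exact: (measurableT_comp (measurable_past noise_measurable i)).
Qed.

(** Functionals of the regressors are only known to be measurable for
    $u \in [0,1]$; clamping makes the composite jointly measurable everywhere. *)
Lemma measurable_at_x_stat (phi : R -> 'cV[R]_d0 -> R) i :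
  measurable_fun (`[0, 1]%classic `*` setT : set (R * vec_space R d0))
    (fun uv : R * vec_space R d0 => phi uv.1 uv.2) ->
  measurable_fun setT
    (fun x : R * T => phi (clamp x.1) (x_stat S (clamp x.1) i x.2)).
Proof.
move=> mphi; apply: (@measurable_comp _ _ _ _ _ _ _ _ _
  (fun x : R * T => (clamp x.1, x_stat S (clamp x.1) i x.2 : vec_space R d0)) _ _
  mphi).
- exact: measurableX.
- by move=> _ /= [x _ <-] /=; split => //; have := clamp_itv x.1.
- apply: measurable_fun_pair; first exact: (measurableT_comp measurable_clamp).
  exact: measurable_x_stat.
Qed.


Section weight.
Variable p : R -> 'cV[R]_d0 -> R.
Hypothesis weight_p : weighted_assumptions P S p.
Variable i : int.

Definition x_field (a : 'I_d0) (x : R * T) : R := x_stat S (clamp x.1) i x.2 a 0.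
Definition weight_field (phi : R -> 'cV[R]_d0 -> R) (x : R * T) : R :=
  phi (clamp x.1) (x_stat S (clamp x.1) i x.2).
Definition X_field (a : 'I_d0) (x : R * T) : R := weight_field p x * x_field a x.
(** $p^2 \sigma x(u)$, whose residual is the vector $A$ with
    $E A A' = \Sigma_2$. *)
Definition Y_field (a : 'I_d0) (x : R * T) : R :=
  (weight_field p x ^+ 2 * weight_field (sigma S) x) * x_field a x.
Definition q_field (u : R) : 'M[R]_(p2, p1) := q_proj P S p (clamp u) i.

Lemma measurable_x_field a : measurable_fun setT (x_field a).
Proof. exact: measurable_fun_coord (measurable_x_stat i). Qed.

Lemma measurable_X_field a : measurable_fun setT (X_field a).
Proof.
apply: measurable_funM; last exact: measurable_x_field.
exact: (measurable_at_x_stat i (weight_measurable weight_p)).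
Qed.

Lemma measurable_Y_field a : measurable_fun setT (Y_field a).
Proof.
apply: measurable_funM; last exact: measurable_x_field.
apply: measurable_funM.
  apply: measurable_funX.
  exact: (measurable_at_x_stat i (weight_measurable weight_p)).
exact: (measurable_at_x_stat i (sigma_measurable model)).
Qed.

Let measurable_p u : u \in `[0, 1] ->
  measurable_fun setT (p u : vec_space R d0 -> R).
Proof. by move=> u01; exact: (measurable_slice u01 (weight_measurable weight_p)). Qed.

Let measurable_x_stat_fun u : u \in `[0, 1] ->
  measurable_fun setT (x_stat_fun S u : seq_space E -> vec_space R d0).
Proof. by move=> u01; exact: (measurable_slice u01 (x_stat_fun_measurable model)). Qed.

Let measurable_scale (f : (nat -> E) -> R) (g : (nat -> E) -> 'cV[R]_d0) :
  measurable_fun setT (f : seq_space E -> R) ->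
  measurable_fun setT (g : seq_space E -> vec_space R d0) ->
  measurable_fun setT ((fun w => f w *: g w) : seq_space E -> vec_space R d0).
Proof.
move=> mf mg; apply: measurable_fun_cylinders => c.
rewrite (_ : _ \o _ = fun w => f w * g w c 0); last first.
  by apply/funext => w /=; rewrite mxE.
by apply: measurable_funM => //; exact: measurable_fun_coord.
Qed.

Let time_itv n j : (1 <= j <= n)%N -> (j%:R / n%:R : R) \in `[0, 1].
Proof.
move=> /andP[j1 jn]; rewrite in_itv/= divr_ge0//= ler_pdivrMr ?mul1r ?ler_nat//.
by rewrite ltr0n (leq_trans j1).
Qed.

Lemma X_stat_L2_bound : exists K : R, forall u, u \in `[0, 1] ->
  (\int[P]_t (sqnorm (X_stat S p u i t))%:E <= K%:E)%E.
Proof.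
have [q [q1 [r2 [[_ hq1 _ _] [_ Joo _]]]]] := weak_dependence weight_p.
apply: (@stationary_L2_bound _ _ _ _ _ P xi d0 noise_measurable noise_is_iid
  (X_fun S p) (fun u w => p u (x_stat_fun S u w) *: x_stat_fun S u w)
  _ _ (2 * q1)) => //.
- move=> n j jn; have mx := x_fun_measurable model jn.
  exact: measurable_scale (measurableT_comp (measurable_p (time_itv jn)) mx) mx.
- move=> u u01; have mx := measurable_x_stat_fun u01.
  exact: measurable_scale (measurableT_comp (measurable_p u01) mx) mx.
- by rewrite ler_peMr// (le_trans _ (ltW hq1))// ler_pdivlMr// mul1r ler_nat.
- have [C hC] := Defs.approximation weight_p; exists C.
  apply: filterS hC => n hn j jn; apply: le_trans (hn j jn).
  by rewrite leeDl// Lnorm_ge0.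
- have [C C0 hC] := time_lipschitz weight_p; exists C => // j u v u01 v01.
  by apply: le_trans (hC j u v u01 v01); rewrite leeDl// Lnorm_ge0.
Qed.

Lemma Xeps_stat_L2_bound : exists K : R, forall u, u \in `[0, 1] ->
  (\int[P]_t (sqnorm (Xeps_stat S p u i t))%:E <= K%:E)%E.
Proof.
have [q [q1 [r2 [[_ _ hr2 _] [_ _ Joo]]]]] := weak_dependence weight_p.
apply: (@stationary_L2_bound _ _ _ _ _ P xi d0 noise_measurable noise_is_iid
  (Xeps_fun S p) (fun u w => (p u (x_stat_fun S u w) * e_stat_fun S u w) *:
     (p u (x_stat_fun S u w) *: x_stat_fun S u w)) _ _ r2) => //.
- move=> n j jn; have mx := x_fun_measurable model jn.
  have mp := measurableT_comp (measurable_p (time_itv jn)) mx.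
  have mpe := measurable_funM mp (e_fun_measurable model jn).
  exact: measurable_scale mpe (measurable_scale mp mx).
- move=> u u01; have mx := measurable_x_stat_fun u01.
  have mp := measurableT_comp (measurable_p u01) mx.
  have mpe := measurable_funM mp (e_stat_fun_measurable model u01).
  exact: measurable_scale mpe (measurable_scale mp mx).
- exact: ltW.
- have [C hC] := Defs.approximation weight_p; exists C.
  apply: filterS hC => n hn j jn; apply: le_trans (hn j jn).
  by rewrite leeDr// Lnorm_ge0.
- have [C C0 hC] := time_lipschitz weight_p; exists C => // j u v u01 v01.
  by apply: le_trans (hC j u v u01 v01); rewrite leeDr// Lnorm_ge0.
Qed.

Lemma X_field_L2 : exists K : R, forall a u,
  (\int[P]_t (X_field a (u, t) ^+ 2)%:E <= K%:E)%E.
Proof.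
have [K hK] := X_stat_L2_bound; exists K => a u.
apply: le_trans (hK _ (clamp_itv u)); apply: ge0_le_integral => //.
- by move=> t _; rewrite lee_fin sqr_ge0.
- apply/measurable_EFinP/measurable_funX.
  exact: measurable_fun_pair2 (measurable_X_field a).
- apply/measurable_EFinP/measurable_sqnorm => c.
  rewrite (_ : (fun t => _) = fun t => X_field c (u, t)).
    exact: measurable_fun_pair2 (measurable_X_field c).
  by apply/funext => t; rewrite mxE.
- by move=> t _; rewrite lee_fin (le_trans _ (sqr_coord_le _ a))// mxE.
Qed.

(** $E p^4 \sigma^2 |x|^2 = E p^4 e^2 |x|^2 = E |X \varepsilon|^2$, as
    $\sigma^2$ is the conditional variance of [e] and $p^4 |x|^2$ is a
    function of the predictable regressors. *)
Lemma Y_field_L2 : exists K : R, forall a u,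
  (\int[P]_t (Y_field a (u, t) ^+ 2)%:E <= K%:E)%E.
Proof.
have [K hK] := Xeps_stat_L2_bound; exists K => a u.
have u01 := clamp_itv u; set v := clamp u in u01.
have xF := x_stat_predictable model i u01.
have sF : past_sigma xi (i - 1) `<=` measurable := @past_sigma_measurable (i - 1).
have mx := measurable_wrt_fun sF xF.
(* $|X \varepsilon|^2 = h(x) e^2$, with [h] evaluated at a predictable vector. *)
pose h (w : 'cV[R]_d0) := p v w ^+ 4 * sqnorm w.
have h0 w : 0 <= h w by rewrite mulr_ge0 ?sqnorm_ge0// exprn_even_ge0.
have mh : measurable_fun setT (h : vec_space R d0 -> R).
  apply: measurable_funM; first by apply: measurable_funX; exact: measurable_p.
  by apply: measurable_sum => c; apply: measurable_funX; exact: measurable_fun_coord.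
have me : measurable_fun setT (e_stat S v i).
  exact: (measurableT_comp (e_stat_fun_measurable model u01)
                           (measurable_past noise_measurable i)).
have ms : measurable_fun setT (sigma_stat S v i).
  have msig : measurable_fun setT (sigma S v : vec_space R d0 -> R).
    exact: (measurable_slice u01 (sigma_measurable model)).
  exact: (measurableT_comp msig mx).
have e2s2 := ge0_integral_mul_transfer (mu := P) mx mh h0
  (measurable_funX 2 me) (fun t => sqr_ge0 _)
  (measurable_funX 2 ms) (fun t => sqr_ge0 _)
  (fun B mB => cond_var_mds sF (e_stat_mds model i u01) (e_stat_var model i u01)
     (xF B mB)).
apply: (@le_trans _ _ (\int[P]_t (h (x_stat S v i t) * sigma_stat S v i t ^+ 2)%:E)%E).
  apply: ge0_le_integral => //.
  - by move=> t _; rewrite lee_fin sqr_ge0.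
  - apply/measurable_EFinP/measurable_funX.
    exact: measurable_fun_pair2 (measurable_Y_field a).
  - apply/measurable_EFinP/measurable_funM; last exact: measurable_funX.
    exact: (measurableT_comp mh mx).
  - move=> t _; rewrite lee_fin /Y_field /weight_field /x_field /h /= -/v.
    rewrite /sigma_stat; set x := x_stat _ _ _ _; set s := sigma _ _ _.
    rewrite (_ : _ ^+ 2 = p v x ^+ 4 * x a 0 ^+ 2 * s ^+ 2); last ring.
    by rewrite ler_wpM2r ?sqr_ge0// ler_wpM2l ?sqr_coord_le// exprn_even_ge0.
rewrite -e2s2; apply: le_trans (hK v u01).
rewrite le_eqVlt; apply/orP; left; apply/eqP; apply: eq_integral => t _.
congr EFin; rewrite /h /sqnorm mulr_sumr mulr_suml; apply: eq_bigr => c _.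
rewrite !mxE /p_stat /= ; ring.
Qed.

Lemma X_field_lipschitz : exists C : R, forall a u v,
  (\int[P]_t ((X_field a (u, t) - X_field a (v, t)) ^+ 2)%:E
     <= ((C * `|u - v|) ^+ 2)%:E)%E.
Proof.
have [C C0 hC] := time_lipschitz weight_p.
exists C => a u v.
have Cuv0 : 0 <= C * `|clamp u - clamp v| by rewrite mulr_ge0 ?(ltW C0).
have := hC i _ _ (clamp_itv u) (clamp_itv v).
move=> /(le_trans (leeDl _ (Lnorm_ge0 _ _ _))) /(Lr_norm2_le Cuv0) D.
apply: (@le_trans _ _ ((C * `|clamp u - clamp v|) ^+ 2)%:E); last first.
  by rewrite lee_fin lerXn2r ?nnegrE ?mulr_ge0 ?(ltW C0)// ler_pM2l// clamp_dist.
apply: le_trans D; apply: ge0_le_integral => //.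
- by move=> t _; rewrite lee_fin sqr_ge0.
- apply/measurable_EFinP/measurable_funX/measurable_funB;
  exact: measurable_fun_pair2 (measurable_X_field a).
- apply/measurable_EFinP/measurable_sqnorm => c.
  rewrite (_ : (fun t => _) = fun t => X_field c (u, t) - X_field c (v, t)).
    by apply: measurable_funB; exact: measurable_fun_pair2 (measurable_X_field c).
  by apply/funext => t; rewrite !mxE.
- by move=> t _; rewrite lee_fin (le_trans _ (sqr_coord_le _ a))// !mxE.
Qed.

Lemma gram_at_X_field u : gram_at (P := P) X_field u =
  mean_mx P (fun t => X_stat S p (clamp u) i t *m (X_stat S p (clamp u) i t)^T).
Proof.
apply/matrixP => a b; rewrite !mxE unlock /Rintegral; congr fine.
by apply: eq_integral => t _; rewrite mxE big_ord1 !mxE.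
Qed.

Lemma gram_at_X_field_unit u : gram_at (P := P) X_field u \in unitmx.
Proof.
by rewrite gram_at_X_field unitmxE unitfE gram_nonsingular// clamp_itv.
Qed.

Lemma q_fieldE u : q_field u =
  invmx (drsubmx (gram_at (P := P) X_field u)) *m dlsubmx (gram_at (P := P) X_field u).
Proof.
rewrite gram_at_X_field; congr (invmx _ *m _); apply/matrixP => a b;
  rewrite !mxE; congr fine; rewrite unlock; apply: eq_integral => t _;
  by rewrite !mxE !big_ord1 !mxE; congr EFin; ring.
Qed.

(** The coefficient is a continuous function of the Gram matrix of $X(u)$, which
    stays invertible for all $u$; so it is continuous in $u$, and bounded by
    compactness. *)
Lemma bounded_q_field : bounded_coef q_field.
Proof.
have [C XC] := X_field_lipschitz.
have [K XK] := X_field_L2.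
have cG := continuous_gram measurable_X_field XK XC.
have cq k a : continuous (fun u => q_field u k a).
  under eq_fun do rewrite q_fieldE.
  apply: continuous_mulmx => [b c|b c]; last first.
    by under eq_fun do rewrite 2!mxE; exact: cG.
  apply: continuous_invmx => [u|b' c']; last first.
    by under eq_fun do rewrite 2!mxE; exact: cG.
  apply: gram_drsub_unit (gram_at_X_field_unit u) => a'.
  exact: (sqint_field (measurable_X_field a') (XK a')).2.
move=> k a; split; first exact: continuous_measurable_fun.
have clamp2 u : clamp (clamp u) = clamp u by rewrite clamp_id// clamp_itv.
have [|M hM] := @continuous_clamp_bounded _ (fun u => q_field u k a).
  rewrite (_ : _ \o _ = fun u => q_field u k a)//.
  by apply/funext => u; rewrite /= /q_field clamp2.
by exists M => u; rewrite (le_trans _ (hM u))// /q_field clamp2.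
Qed.

Lemma sqint_X_field :
  (forall a, sqint (unif \x P)%E (X_field a)) /\
  (forall u a, sqint P (fun t => X_field a (u, t))).
Proof.
have [K XK] := X_field_L2.
by split=> [a|u a]; have [? ?] := sqint_field (measurable_X_field a) (XK a).
Qed.

Lemma sqint_Y_field a : sqint (unif \x P)%E (Y_field a).
Proof.
have [K YK] := Y_field_L2.
by have [? ?] := sqint_field (measurable_Y_field a) (YK a).
Qed.

Lemma sqint_residual_X r a : bounded_coef r ->
  sqint (unif \x P)%E (residual (r \o fst) X_field a).
Proof. by move=> br; exact: (sqint_residual a br sqint_X_field.1). Qed.

Lemma x1_tilde_residual x a :
  x1_tilde P S p (clamp x.1) i x.2 a 0 = residual (q_field \o fst) x_field a x.
Proof.
rewrite /x1_tilde !mxE; congr (_ - _); apply: eq_bigr => k _.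
by rewrite !mxE.
Qed.

Let q_field_gram : q_field = fun u =>
  invmx (drsubmx (gram_at (P := P) X_field u)) *m dlsubmx (gram_at (P := P) X_field u).
Proof. by apply/funext => u; exact: q_fieldE. Qed.

Lemma gram_residual_X_change r : bounded_coef r ->
  gram (unif \x P)%E (residual (q_field \o fst) X_field) (residual (r \o fst) X_field)
  = gram (unif \x P)%E (residual (q_field \o fst) X_field)
                       (residual (q_field \o fst) X_field).
Proof.
move=> br; have := bounded_q_field; rewrite q_field_gram => bq.
exact: (gram_residual_change sqint_X_field.1 sqint_X_field.2 gram_at_X_field_unit bq br).
Qed.

Lemma gram_residual_X_unit :
  gram (unif \x P)%E (residual (q_field \o fst) X_field)
                     (residual (q_field \o fst) X_field) \in unitmx.
Proof.
have := bounded_q_field; rewrite q_field_gram => bq.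
exact: (gram_residual_unit sqint_X_field.1 sqint_X_field.2 gram_at_X_field_unit bq).
Qed.

Lemma Sigma1_gram : Sigma1 P S p i =
  gram (unif \x P)%E (residual (q_field \o fst) X_field)
                     (residual (q_field \o fst) X_field).
Proof.
have entryE x a b : (p_stat S p (clamp x.1) i x.2 ^+ 2 *:
    (x1_tilde P S p (clamp x.1) i x.2 *m (x1_tilde P S p (clamp x.1) i x.2)^T)) a b
  = residual (q_field \o fst) X_field a x * residual (q_field \o fst) X_field b x.
  rewrite !residual_mul mxE [X in _ * X]mxE big_ord1 [X in _ * (_ * X)]mxE.
  by rewrite !x1_tilde_residual /p_stat /weight_field; ring.
apply/matrixP => a b; rewrite mean_int_mxE.
  by rewrite mxE; apply: eq_Rintegral => x _; exact: entryE.
under eq_fun do rewrite entryE.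
by apply: integrable_mul_sqint; exact: sqint_residual_X bounded_q_field.
Qed.

Lemma Sigma2_gram : Sigma2 P S p i =
  gram (unif \x P)%E (residual (q_field \o fst) Y_field)
                     (residual (q_field \o fst) Y_field).
Proof.
have entryE x a b : ((p_stat S p (clamp x.1) i x.2 ^+ 4
      * sigma_stat S (clamp x.1) i x.2 ^+ 2) *:
    (x1_tilde P S p (clamp x.1) i x.2 *m (x1_tilde P S p (clamp x.1) i x.2)^T)) a b
  = residual (q_field \o fst) Y_field a x * residual (q_field \o fst) Y_field b x.
  rewrite !residual_mul mxE [X in _ * X]mxE big_ord1 [X in _ * (_ * X)]mxE.
  by rewrite !x1_tilde_residual /p_stat /sigma_stat /weight_field; ring.
apply/matrixP => a b; rewrite mean_int_mxE.
  by rewrite mxE; apply: eq_Rintegral => x _; exact: entryE.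
under eq_fun do rewrite entryE.
by apply: integrable_mul_sqint; exact: sqint_residual bounded_q_field sqint_Y_field.
Qed.

Lemma Sigma1_unit : Sigma1 P S p i \in unitmx.
Proof. by rewrite Sigma1_gram gram_residual_X_unit. Qed.

End weight.

Lemma Sigma_starE i : Sigma_star P S i = Sigma1 P S (inv_sigma S) i.
Proof.
have qE u : q_proj_star P S u i = q_proj P S (inv_sigma S) u i.
  by rewrite /q_proj_star /q_proj; congr (invmx _ *m _); apply/matrixP => a b;
    rewrite !mxE; congr fine; rewrite unlock; apply: eq_integral => t _;
    rewrite !mxE exprVn.
rewrite /Sigma_star /Sigma1; apply: (congr1 (@mean_int_mx _ _ _ P _ _)).
apply/funext => u; apply/funext => t.
by rewrite /x1_tilde_star qE exprVn.
Qed.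

(** $\sigma^{-4} \sigma^2 = \sigma^{-2}$ in the integrand. *)
Lemma Sigma2_inv_sigma i : Sigma2 P S (inv_sigma S) i = Sigma1 P S (inv_sigma S) i.
Proof.
rewrite /Sigma2 /Sigma1; congr mean_int_mx.
apply/funext => u; apply/funext => t; congr (_ *: _).
rewrite /p_stat /inv_sigma -/(sigma_stat S u i t).
have [->|s0] := eqVneq (sigma_stat S u i t) 0; first by rewrite invr0 !expr0n/= mulr0.
by rewrite !exprVn; field.
Qed.

(** $(p^2 \sigma \widetilde x_1) (\sigma^{-1} \widetilde x_1^\ast)' =
    (p \widetilde x_1) (p \widetilde x_1^\ast)'$: the mixed moment is a moment of
    two residuals for the same weight [p], one of them taken with the
    coefficients of the optimal weight, which may then be exchanged. *)
Lemma gram_cross p i (weight_p : weighted_assumptions P S p)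
    (weight_opt : weighted_assumptions P S (inv_sigma S)) :
  gram (unif \x P)%E (residual (q_field p i \o fst) (Y_field p i))
    (residual (q_field (inv_sigma S) i \o fst) (X_field (inv_sigma S) i))
  = Sigma1 P S p i.
Proof.
rewrite (Sigma1_gram weight_p).
rewrite -(gram_residual_X_change weight_p i (bounded_q_field weight_opt i)).
apply/matrixP => a b; rewrite !mxE; apply: eq_Rintegral => x _.
rewrite !residual_mul /weight_field /inv_sigma.
have s0 : sigma S (clamp x.1) (x_stat S (clamp x.1) i x.2) != 0.
  by rewrite gt_eqF// (sigma_gt0 model)// clamp_itv.
move: (residual _ _ _ _) (residual _ _ _ _) => A B.
by field.
Qed.

End stationary_fields.

Theorem mainTheorem4 (R : realType) (dT dE : measure_display)
    (T : measurableType dT) (E : measurableType dE) (P : probability T R)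
    (p1 p2 : nat) (S : regression R T E p1 p2)
    (p : R -> 'cV[R]_(p1 + p2) -> R) (i : int)
    (model : regression_model P S)
    (weight_p : weighted_assumptions P S p)
    (weight_opt : weighted_assumptions P S (inv_sigma S)) :
  [/\ Sigma1 P S p i \in unitmx,
      Sigma_star P S i \in unitmx,
      (forall z : 'cV[R]_p1,
         (z^T *m invmx (Sigma_star P S i) *m z) 0 0
         <= (z^T *m (invmx (Sigma1 P S p i) *m Sigma2 P S p i
                     *m invmx (Sigma1 P S p i)) *m z) 0 0) &
      invmx (Sigma1 P S (inv_sigma S) i) *m Sigma2 P S (inv_sigma S) i
        *m invmx (Sigma1 P S (inv_sigma S) i)
      = invmx (Sigma_star P S i)].
Proof.
have u1 := Sigma1_unit model weight_p i.
have us := Sigma1_unit model weight_opt i.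
rewrite Sigma_starE Sigma2_inv_sigma; split; [exact: u1|exact: us| |].
- move=> z; have cross := gram_cross model i weight_p weight_opt.
  rewrite (Sigma2_gram model weight_p) (Sigma1_gram model weight_opt) -cross.
  apply: gram_sandwich_ge.
  + move=> a; apply: sqint_residual (bounded_q_field model weight_p i) _.
    exact: sqint_Y_field.
  + move=> a; exact: sqint_residual_X (bounded_q_field model weight_opt i).
  + by rewrite cross.
  + by rewrite cross (Sigma1_gram model weight_p) tr_gram.
  + exact: gram_residual_X_unit.
- by rewrite (mulVmx us) mul1mx.
Qed.
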